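(* Let $g\geq 4$. The second Hilbert point of a polarized $K3$ surface $[X,L]\in \mathcal{F}_g \setminus D_g^{\mathrm{rk} 4}$ is semistable.
   Context: $\mathcal{F}_g$ is the moduli space of pairs $[X,L]$ with $X$ a smooth complex $K3$ surface and $L$ a big and nef line bundle with $L^2=2g-2$. $I_{X,L}(2):=\mathrm{Ker}\{\mathrm{Sym}^2H^0(X,L)\to H^0(X,L^{\otimes 2})\}$, and $$D_g^{\mathrm{rk} 4}:=\Bigl\{[X,L]\in \mathcal{F}_g: \exists \ 0\neq q\in I_{X,L}(2), \ \mathrm{rk}(q)\leq 4\Bigr\},$$ where $\mathrm{rk}(q)$ is the rank of $q$ as a quadric. When the multiplication map is surjective, the second Hilbert point of $[X,L]$ is the quotient $$[X,L]_2:=\Bigl[\mathrm{Sym}^2 H^0(X,L)\longrightarrow H^0(X,L^{\otimes 2})\longrightarrow 0\Bigr]\in \mathrm{Gr}\bigl(\mathrm{Sym}^2H^0(X,L),4g-2\bigr),$$ a point of the Grassmannian of $(4g-2)$-dimensional quotients. (Here $h^0(X,L^{\otimes 2})=4g-2$; outside $D_g^{\mathrm{rk}4}$ the multiplication map is surjective.) Fix $V\cong\mathbb C^{g+1}$ and an identification $V\cong H^0(X,L)$. Semistability is in the sense of Geometric Invariant Theory for the action of $SL(V)$ on $\mathrm{Gr}(\mathrm{Sym}^2V,4g-2)$, linearized by the Plücker embedding $\mathrm{Gr}(\mathrm{Sym}^2V,4g-2)\subseteq\mathbf{P}\bigl(\bigwedge^{4g-2}\mathrm{Sym}^2V^\vee\bigr)$.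 *)

(* Defs.v *)
(* Projective varieties are taken in the classical
   sense (reduced closed subsets of P^N over an algebraically closed field, with
   regular functions as genuine functions), and line bundles as cocycles of
   transition functions; cohomology is Cech cohomology of the standard affine
   covering. *)
From HB Require Import structures.
From mathcomp Require Import all_boot all_order all_algebra.
From mathcomp Require Import mpoly.

Set Implicit Arguments.
Unset Strict Implicit.
Unset Printing Implicit Defensive.

Import GRing.Theory.
Local Open Scope ring_scope.

(* Equality in [Z] is taken modulo [B]; this is also how functions that matter
   only on a part of [T] are identified. *)
Definition quot_basis (K : fieldType) (T : Type) (Z B : (T -> K) -> Prop)
    (d : nat) (b : 'I_d -> T -> K) : Prop :=
  (forall i, Z (b i)) /\
  forall z, Z z -> exists! c : 'rV[K]_d,
    B (fun t => z t - \sum_(i < d) c 0 i * b i t).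

Definition quot_dim (K : fieldType) (T : Type) (Z B : (T -> K) -> Prop)
    (d : nat) : Prop :=
  exists b : 'I_d -> T -> K, quot_basis Z B b.

(* Subsets of P^N are represented by the corresponding cones in K^(N+1),
   deprived of the origin. *)
Definition hpoint (K : fieldType) (N : nat) : Type := 'I_N.+1 -> K.

Definition nonzero (K : fieldType) (N : nat) (x : hpoint K N) : Prop :=
  exists i, x i != 0.

Definition zclosed (K : fieldType) (N : nat) (X : hpoint K N -> Prop) : Prop :=
  exists2 S : {mpoly K[N.+1]} -> Prop,
    (forall F, S F -> exists d, F \is d.-homog) &
    forall x, X x <-> nonzero x /\ (forall F, S F -> F.@[x] = 0).

Definition zopen (K : fieldType) (N : nat) (U : hpoint K N -> Prop) : Prop :=
  zclosed (fun x => nonzero x /\ ~ U x).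

Definition zirreducible (K : fieldType) (N : nat) (X : hpoint K N -> Prop) :
    Prop :=
  (exists x, X x) /\
  forall A B : hpoint K N -> Prop, zclosed A -> zclosed B ->
    (forall x, X x -> A x \/ B x) ->
    (forall x, X x -> A x) \/ (forall x, X x -> B x).

Definition zchain (K : fieldType) (N : nat) (X : hpoint K N -> Prop) (d : nat) :
    Prop :=
  exists Z : nat -> hpoint K N -> Prop,
    (forall i, (i <= d)%N ->
       [/\ zclosed (Z i), zirreducible (Z i) & forall x, Z i x -> X x]) /\
    (forall i, (i < d)%N ->
       (forall x, Z i x -> Z i.+1 x) /\ exists2 x, Z i.+1 x & ~ Z i x).

Definition zdim (K : fieldType) (N : nat) (X : hpoint K N -> Prop) (d : nat) :
    Prop :=
  zchain X d /\ ~ zchain X d.+1.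

Definition subvariety (K : fieldType) (N : nat) (X : hpoint K N -> Prop)
    (d : nat) : Prop :=
  [/\ zclosed X, zirreducible X & zdim X d].

(* [A] is locally closed. Since any neighbourhood of a point contains a
   principal one, the neighbourhood can be taken to be the locus where the
   denominator does not vanish. *)
Definition regular (K : fieldType) (N : nat) (A : hpoint K N -> Prop)
    (f : hpoint K N -> K) : Prop :=
  forall x, A x -> exists d (P Q : {mpoly K[N.+1]}),
    [/\ P \is d.-homog, Q \is d.-homog, Q.@[x] != 0 &
        forall y, A y -> Q.@[y] != 0 -> f y = P.@[y] / Q.@[y]].

(* Tangent space at [x] of the affine cone over [X]; the Zariski tangent space
   of [X] at [x] is its quotient by the line spanned by [x]. *)
Definition cone_tangent (K : fieldType) (N : nat) (X : hpoint K N -> Prop)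
    (x v : hpoint K N) : Prop :=
  forall d (F : {mpoly K[N.+1]}), F \is d.-homog ->
    (forall y, X y -> F.@[y] = 0) ->
    \sum_(i < N.+1) v i * (F^`M(i)).@[x] = 0.

Definition radial (K : fieldType) (N : nat) (x v : hpoint K N) : Prop :=
  exists a : K, forall i, v i = a * x i.

Definition smooth_variety (K : fieldType) (N : nat) (X : hpoint K N -> Prop)
    (d : nat) : Prop :=
  subvariety X d /\
  forall x, X x -> quot_dim (cone_tangent X x) (radial x) d.

(* A pair (P, Q) of forms of the same degree stands for the rational function
   P / Q on P^N. *)
Definition hfrac (K : fieldType) (N : nat) : Type :=
  ({mpoly K[N.+1]} * {mpoly K[N.+1]})%type.

Definition hfrac_ok (K : fieldType) (N : nat) (f : hfrac K N) : Prop :=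
  exists d, f.1 \is d.-homog /\ f.2 \is d.-homog.

Definition hfrac_val (K : fieldType) (N : nat) (f : hfrac K N) (x : hpoint K N) :
    K :=
  f.1.@[x] / f.2.@[x].

Definition mdirder (K : fieldType) (N : nat) (F : {mpoly K[N.+1]})
    (x v : hpoint K N) : K :=
  \sum_(i < N.+1) v i * (F^`M(i)).@[x].

Definition hfrac_der (K : fieldType) (N : nat) (f : hfrac K N)
    (x v : hpoint K N) : K :=
  (mdirder f.1 x v * f.2.@[x] - f.1.@[x] * mdirder f.2 x v) / f.2.@[x] ^+ 2.

(* [w x] is an alternating form on the tangent space of [X] at [x], given on the
   tangent space of the cone. Near every point, [w] has to be a finite sum of
   terms f dg /\ dh with f, g, h regular. *)
Definition regular_2form (K : fieldType) (N : nat) (X : hpoint K N -> Prop)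
    (w : hpoint K N -> hpoint K N -> hpoint K N -> K) : Prop :=
  forall x, X x -> exists m (f g h : 'I_m -> hfrac K N),
    (forall a, [/\ hfrac_ok (f a), hfrac_ok (g a) & hfrac_ok (h a)]) /\
    (forall a, [/\ (f a).2.@[x] != 0, (g a).2.@[x] != 0 & (h a).2.@[x] != 0]) /\
    forall y, X y ->
      (forall a,
         [/\ (f a).2.@[y] != 0, (g a).2.@[y] != 0 & (h a).2.@[y] != 0]) ->
      forall u v, cone_tangent X y u -> cone_tangent X y v ->
        w y u v =
        \sum_(a < m) hfrac_val (f a) y *
          (hfrac_der (g a) y u * hfrac_der (h a) y v
           - hfrac_der (g a) y v * hfrac_der (h a) y u).

(* For a smooth surface: the canonical bundle has a nowhere vanishing section. *)
Definition trivial_canonical (K : fieldType) (N : nat)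
    (X : hpoint K N -> Prop) : Prop :=
  exists2 w, regular_2form X w &
    forall x, X x -> exists u v,
      [/\ cone_tangent X x u, cone_tangent X x v & w x u v != 0].

(* The opens [bU i] live in P^N and [bg i j] is the transition function on
   [bU i] /\ [bU j]; only their traces on a given subvariety matter, so that
   the restriction of a line bundle to a smaller subvariety is the same datum. *)
Record bundle (K : fieldType) (N : nat) := Bundle {
  bn : nat;
  bU : 'I_bn -> hpoint K N -> Prop;
  bg : 'I_bn -> 'I_bn -> hpoint K N -> K }.

Definition line_bundle (K : fieldType) (N : nat) (Y : hpoint K N -> Prop)
    (L : bundle K N) : Prop :=
  [/\ forall i : 'I_(bn L), zopen (bU i),
      forall x, Y x -> exists i : 'I_(bn L), bU i x,
      forall i j : 'I_(bn L),
        regular (fun x => [/\ Y x, bU i x & bU j x]) (bg i j),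
      forall (i j : 'I_(bn L)) x, Y x -> bU i x -> bU j x -> bg i j x != 0 &
      forall (i j k : 'I_(bn L)) x, Y x -> bU i x -> bU j x -> bU k x ->
        bg i j x * bg j k x = bg i k x].

Definition bundle1 (K : fieldType) (N : nat) : bundle K N :=
  @Bundle K N 1 (fun _ _ => True) (fun _ _ _ => 1).

Definition bundle_pow (K : fieldType) (N : nat) (L : bundle K N) (m : int) :
    bundle K N :=
  @Bundle K N (bn L) (@bU _ _ L) (fun i j x => bg i j x ^ m).

(* [s (i, x)] is the value at [x] of the section in the [i]-th trivialisation. *)
Definition section (K : fieldType) (N : nat) (Y : hpoint K N -> Prop)
    (L : bundle K N) (W : hpoint K N -> Prop)
    (s : 'I_(bn L) * hpoint K N -> K) : Prop :=
  (forall i : 'I_(bn L),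
     regular (fun x => [/\ Y x, W x & bU i x]) (fun x => s (i, x))) /\
  (forall (i j : 'I_(bn L)) x, Y x -> W x -> bU i x -> bU j x ->
     s (i, x) = bg i j x * s (j, x)).

Definition global_section (K : fieldType) (N : nat) (Y : hpoint K N -> Prop)
    (L : bundle K N) (s : 'I_(bn L) * hpoint K N -> K) : Prop :=
  section Y (fun _ => True) s.

Definition zero_section (K : fieldType) (N : nat) (Y : hpoint K N -> Prop)
    (L : bundle K N) (s : 'I_(bn L) * hpoint K N -> K) : Prop :=
  forall (i : 'I_(bn L)) x, Y x -> bU i x -> s (i, x) = 0.

(* A basis of H^0(Y, L), i.e. an identification of K^d with H^0(Y, L). *)
Definition H0_basis (K : fieldType) (N : nat) (Y : hpoint K N -> Prop)
    (L : bundle K N) (d : nat)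
    (s : 'I_d -> 'I_(bn L) * hpoint K N -> K) : Prop :=
  quot_basis (@global_section K N Y L) (@zero_section K N Y L) s.

(* Non-alternating Cech complex for the affine covering {x_i != 0} of [Y]. *)
Definition cech_ix (N p : nat) : Type := {ffun 'I_p.+1 -> 'I_N.+1}.

Definition cech_open (K : fieldType) (N p : nat) (a : cech_ix N p)
    (x : hpoint K N) : Prop :=
  forall k, x (a k) != 0.

Definition cochain (K : fieldType) (N : nat) (L : bundle K N) (p : nat) : Type :=
  cech_ix N p * ('I_(bn L) * hpoint K N) -> K.

Definition is_cochain (K : fieldType) (N : nat) (Y : hpoint K N -> Prop)
    (L : bundle K N) (p : nat) (c : cochain L p) : Prop :=
  forall a : cech_ix N p, section Y (cech_open a) (fun t => c (a, t)).

Definition cech_face (N p : nat) (a : cech_ix N p.+1) (k : 'I_p.+2) :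
    cech_ix N p :=
  [ffun j : 'I_p.+1 => a (lift k j)].

Definition cech_diff (K : fieldType) (N : nat) (L : bundle K N) (p : nat)
    (c : cochain L p) : cochain L p.+1 :=
  fun t => \sum_(k < p.+2) (-1) ^+ k * c (cech_face t.1 k, t.2).

Definition cochain_eq (K : fieldType) (N : nat) (Y : hpoint K N -> Prop)
    (L : bundle K N) (p : nat) (c c' : cochain L p) : Prop :=
  forall (a : cech_ix N p) (i : 'I_(bn L)) (x : hpoint K N),
    Y x -> bU i x -> cech_open a x -> c (a, (i, x)) = c' (a, (i, x)).

Definition cocycle (K : fieldType) (N : nat) (Y : hpoint K N -> Prop)
    (L : bundle K N) (p : nat) (c : cochain L p) : Prop :=
  is_cochain Y c /\ cochain_eq Y (cech_diff c) (fun _ => 0).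

Definition coboundary (K : fieldType) (N : nat) (Y : hpoint K N -> Prop)
    (L : bundle K N) (p : nat) : cochain L p -> Prop :=
  match p return cochain L p -> Prop with
  | 0 => fun c => cochain_eq Y c (fun _ => 0)
  | q.+1 => fun c =>
      exists2 b : cochain L q, is_cochain Y b & cochain_eq Y c (cech_diff b)
  end.

(* dim H^p(Y, L) = d *)
Definition has_hdim (K : fieldType) (N : nat) (Y : hpoint K N -> Prop)
    (L : bundle K N) (p d : nat) : Prop :=
  quot_dim (@cocycle K N Y L p) (@coboundary K N Y L p) d.

(* H^p(Y, L) = 0 for p > N, as the covering has N + 1 members. *)
Definition has_euler (K : fieldType) (N : nat) (Y : hpoint K N -> Prop)
    (L : bundle K N) (e : int) : Prop :=
  exists2 h : nat -> nat,
    (forall p, (p <= N)%N -> has_hdim Y L p (h p)) &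
    e = \sum_(p < N.+1) (-1) ^+ p * (h p)%:Z.

(* The intersection number (L^d . Y), Y of dimension d, defined by
     (L^d . Y) = \sum_(i <= d) (-1)^i binom(d, i) chi(Y, L^(-i)).
   For d = 1 this is deg(L|Y) = chi(O) - chi(L^-1). *)
Definition self_intersection (K : fieldType) (N : nat) (Y : hpoint K N -> Prop)
    (L : bundle K N) (d : nat) (e : int) : Prop :=
  exists2 chi : nat -> int,
    (forall i, (i <= d)%N -> has_euler Y (bundle_pow L (- i%:Z)) (chi i)) &
    e = \sum_(i < d.+1) (-1) ^+ i * ('C(d, i))%:Z * chi i.

Definition nef (K : fieldType) (N : nat) (X : hpoint K N -> Prop)
    (L : bundle K N) : Prop :=
  forall C : hpoint K N -> Prop, subvariety C 1 -> (forall x, C x -> X x) ->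
    exists2 e : int, self_intersection C L 1 e & 0 <= e.

(* X of dimension d: h^0(X, L^m) grows like m^d. *)
Definition big (K : fieldType) (N : nat) (X : hpoint K N -> Prop)
    (L : bundle K N) (d : nat) : Prop :=
  exists a m0 : nat, forall m : nat, (m0 <= m)%N ->
    exists h (b : 'I_h -> 'I_(bn (bundle_pow L m)) * hpoint K N -> K),
      H0_basis X b /\ (m ^ d <= a * h)%N.

Definition K3_surface (K : fieldType) (N : nat) (X : hpoint K N -> Prop) :
    Prop :=
  [/\ smooth_variety X 2, trivial_canonical X &
      has_hdim X (bundle1 K N) 1 0].

(* [X, L] is a point of the moduli space F_g. *)
Definition polarized_K3 (K : fieldType) (g N : nat) (X : hpoint K N -> Prop)
    (L : bundle K N) : Prop :=
  [/\ K3_surface X, line_bundle X L, big X L 2, nef X L &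
      self_intersection X L 2 (2 * g%:Z - 2)].

(* Given a basis s of V = H^0(X, L), elements of Sym^2 V are represented by
   symmetric matrices A, standing for \sum_(a, b) A a b s_a s_b (the
   characteristic is not 2); the rank of a quadric is that of the matrix. *)

(* The quadric A lies in I_{X,L}(2): its image in H^0(X, L^2) is zero. *)
Definition in_I2 (K : fieldType) (N : nat) (X : hpoint K N -> Prop)
    (L : bundle K N) (n : nat) (s : 'I_n -> 'I_(bn L) * hpoint K N -> K)
    (A : 'M[K]_n) : Prop :=
  A^T = A /\
  zero_section (L := bundle_pow L 2) X
    (fun t => \sum_(a < n) \sum_(b < n) A a b * (s a t * s b t)).

Definition D_rk4 (K : fieldType) (N : nat) (X : hpoint K N -> Prop)
    (L : bundle K N) : Prop :=
  exists n (s : 'I_n -> 'I_(bn L) * hpoint K N -> K) (A : 'M[K]_n),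
    [/\ H0_basis X s, in_I2 X s A, A != 0 & (\rank A <= 4)%N].

(* V = K^n with basis e_a. A linear map Sym^2 V -> K^k is given by its k
   components, which are symmetric bilinear forms on V:
   e_a e_b |-> (P t a b)_t. *)
Definition sym2_map (K : fieldType) (n k : nat) : Type := 'I_k -> 'M[K]_n.

(* Surjective maps; they are the frames of the points of Gr(Sym^2 V, k), two of
   them giving the same point iff they differ by an element of GL_k. *)
Definition in_Gr (K : fieldType) (n k : nat) (P : sym2_map K n k) : Prop :=
  (forall t, (P t)^T = P t) /\
  forall y : 'rV[K]_k, exists2 A : 'M[K]_n, A^T = A &
    forall t, \sum_(a < n) \sum_(b < n) A a b * P t a b = y 0 t.

(* The basis e_a e_b, a <= b, of Sym^2 V. *)
Definition mon2 (n : nat) : finType :=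
  {ab : 'I_n * 'I_n | (ab.1 <= ab.2)%N} : finType.

Definition mon2_nth (n : nat) (i : 'I_#|mon2 n|) : 'I_n * 'I_n :=
  val (enum_val i).

(* Increasing k-tuples of elements of this basis. *)
Definition plucker_ix (n k : nat) : finType :=
  {f : {ffun 'I_k -> 'I_#|mon2 n|} |
     [forall r : 'I_k, forall r' : 'I_k, (r < r')%N ==> (f r < f r')%N]} : finType.

Definition plucker (K : fieldType) (n k : nat) (P : sym2_map K n k)
    (I : 'I_#|plucker_ix n k|) : K :=
  \det (\matrix_(r < k, t < k)
          P t (mon2_nth (val (enum_val I) r)).1
              (mon2_nth (val (enum_val I) r)).2).

(* Action of h in SL(V) on quotients of Sym^2 V, with V as the space of row
   vectors: (h . q)(v, w) = q(v h, w h). *)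
Definition sym2_act (K : fieldType) (n k : nat) (h : 'M[K]_n)
    (P : sym2_map K n k) : sym2_map K n k :=
  fun t => h *m P t *m h^T.

(* A form F of degree d in the Pluecker coordinates defines a section of O(d) on
   the Grassmannian; F is required to be SL(V)-invariant as such a section, i.e.
   on the affine cone over the Grassmannian. *)
Definition semistable (K : fieldType) (n k : nat) (P : sym2_map K n k) : Prop :=
  exists d (F : {mpoly K[#|plucker_ix n k|]}),
    [/\ (0 < d)%N, F \is d.-homog,
        (forall (h : 'M[K]_n) (Q : sym2_map K n k), \det h = 1 -> in_Gr Q ->
           F.@[plucker (sym2_act h Q)] = F.@[plucker Q]) &
        F.@[plucker P] != 0].

(* P is (a frame of) the quotient Sym^2 H^0(X, L) -> H^0(X, L^2), with V = K^n
   identified to H^0(X, L) by the basis s, and H^0(X, L^2) to K^k by some basis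
   u: the product s_a s_b has coordinates (P l a b)_l in the basis u. *)
Definition second_Hilbert_point (K : fieldType) (N : nat)
    (X : hpoint K N -> Prop) (L : bundle K N) (n k : nat)
    (s : 'I_n -> 'I_(bn L) * hpoint K N -> K) (P : sym2_map K n k) : Prop :=
  exists u : 'I_k -> 'I_(bn (bundle_pow L 2)) * hpoint K N -> K,
    H0_basis X u /\
    forall a b, zero_section (L := bundle_pow L 2) X
      (fun t => s a t * s b t - \sum_(l < k) P l a b * u l t).

(* Main.v *)
(* The symmetric matrices of rank at most 4 in Sym^2 V form a cone X, the image of
   Y |-> Y^T Y for Y of size 4 x (g+1), of dimension k = 4g - 2. A point of the
   Grassmannian is given by k linear forms on Sym^2 V, that is, by a matrix Q with k
   rows, and by hypothesis the k forms given by P have no common nonzero zero on X.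
   The Q whose forms do have such a zero are the zeros of the Chow form of X, which
   we show to be an invariant of SL(V) not vanishing at P.

   The polynomials in the entries of Q vanishing on this locus form a prime ideal. By
   the Nullstellensatz, one of them does not vanish at P. As dim X = k, any k - 1
   linear forms have a common nonzero zero on X (Hilbert functions are compared); so,
   for some i, the ideal contains no nonzero polynomial free of the i-th entry of the
   first row, and it is therefore principal. Its generator F is unique up to a scalar,
   hence is multiplied by a character under the actions of GL_k and GL(V): this
   character is a power of the determinant. So F is invariant under SL(V), and
   F (g Q) = det(g)^d F (Q) makes F a form of degree d in the Pluecker coordinates.
   The bound on the dimension of X also shows that P is surjective. *)
Require Import Defs.
From HB Require Import structures.
From mathcomp Require Import all_boot all_order all_algebra fingroup perm.
From mathcomp Require Import mpoly ssrcomplements zify.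
From mathcomp Require Import boolp classical_sets reals complex.

Set Implicit Arguments.
Unset Strict Implicit.
Unset Printing Implicit Defensive.

Import Order.TTheory GRing.Theory Num.Theory.
Local Open Scope ring_scope.

(** * Unique factorization in polynomial rings *)

(** The number 4g - 2 is 4n - 6 with n = g + 1: the 4n entries of Y, less the dimension 6 of the
    orthogonal group O(4), which fixes Y^T Y. Height and dimension theory are replaced by elementary
    means: polynomial rings are UFDs, and a prime ideal without nonzero elements free of one chosen
    variable becomes principal by pseudo-division in that variable and Gauss's lemma. The
    Nullstellensatz comes from counting dimensions over an uncountable field, hence the proof that
    the complex numbers are uncountable. The passage from F (g Q) = det(g)^d F (Q) to Pluecker
    coordinates is the first fundamental theorem for SL_k: F is written as a sum of powers of linear
    forms, and g |-> F (g Q) is paired with det^d, which amounts to Cayley's Omega process. *)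

Definition divides (D : idomainType) (a b : D) : Prop := exists c, b = c * a.

Definition irreducible_elt (D : idomainType) (p : D) : Prop :=
  [/\ p != 0, p \isn't a GRing.unit &
      forall a b, p = a * b -> a \is a GRing.unit \/ b \is a GRing.unit].

Definition prime_elt (D : idomainType) (p : D) : Prop :=
  forall a b, divides p (a * b) -> divides p a \/ divides p b.

(* The measure [mu] bounds the length of the chains of divisors. *)
Definition ufd (D : idomainType) : Prop :=
  exists2 mu : D -> nat,
    (forall a b, a != 0 -> b != 0 ->
       (mu a <= mu (a * b)%R ?= iff (b \is a GRing.unit))%N) &
    forall p : D, irreducible_elt p -> prime_elt p.

Section UFDPoly.
Variable D : idomainType.
Implicit Types (f g h : {poly D}) (a b c p : D).

Lemma divides_mulr (E : idomainType) (a b c : E) :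
  divides a b -> divides a (c * b).
Proof. by case=> d ->; exists (c * d); rewrite mulrA. Qed.

Lemma dividesD (E : idomainType) (a b c : E) :
  divides a b -> divides a c -> divides a (b + c).
Proof. by case=> d -> [e ->]; exists (d + e); rewrite mulrDl. Qed.

Lemma dividesB (E : idomainType) (a b c : E) :
  divides a b -> divides a c -> divides a (b - c).
Proof. by case=> d -> [e ->]; exists (d - e); rewrite mulrBl. Qed.

Lemma poly_unit_const c : (c%:P \is a GRing.unit) = (c \is a GRing.unit).
Proof.
rewrite poly_unitE size_polyC coefC eqxx.
by have [->|] := eqVneq c 0; rewrite ?unitr0.
Qed.

(** Gauss's lemma, by induction on the sum of the sizes. The prime [p] divides the product of the
    leading coefficients, hence one of them; [cut] removes that leading term without changing the
    polynomial modulo [p]. *)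
Lemma prime_polyC p : p != 0 -> prime_elt p -> prime_elt p%:P.
Proof.
move=> p0 pp f g; move: {2}(size f + size g)%N (leqnn (size f + size g)) => n.
elim: n f g => [|n IHn] f g.
  rewrite leqn0 addn_eq0 size_poly_eq0 => /andP[/eqP -> _] _.
  by left; exists 0; rewrite mul0r.
have [->|f0] := eqVneq f 0; first by left; exists 0; rewrite mul0r.
have [->|g0] := eqVneq g 0; first by right; exists 0; rewrite mul0r.
move=> le_n dvd_fg.
have dvdlead : divides p (lead_coef f * lead_coef g).
  by case: dvd_fg => h e; exists (lead_coef h);
    rewrite -lead_coefM e lead_coefM lead_coefC.
have cut (q : {poly D}) : q != 0 -> divides p (lead_coef q) ->
    exists2 q' : {poly D}, (size q' < size q)%N & divides p%:P (q - q').
  move=> q0 [c ec]; exists (q - lead_coef q *: 'X^((size q).-1)).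
    have sq : (0 < size q)%N by rewrite size_poly_gt0.
    rewrite -[X in (_ < X)%N](prednK sq) ltnS; apply/leq_sizeP => j.
    rewrite leq_eqVlt => /orP[/eqP <-|lt_j].
      by rewrite coefB coefZ coefXn eqxx mulr1 subrr.
    rewrite coefB coefZ coefXn gtn_eqF // mulr0 subr0 nth_default //.
    by rewrite -(prednK sq).
  rewrite opprB addrCA subrr addr0 ec.
  by exists (c *: 'X^((size q).-1)); rewrite [RHS]mulrC mul_polyC scalerA mulrC.
case: (pp _ _ dvdlead) => /cut[] // q [ltq dvdq].
  have dq : divides p%:P (q * g).
    have -> : q * g = f * g - g * (f - q).
      by rewrite mulrBr opprB [f * g]mulrC [q * g]mulrC addrC subrK.
    by apply: dividesB => //; apply: divides_mulr.
  have [|dq'|] := IHn q g _ dq; [| |by right].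
    by rewrite -ltnS (leq_trans _ le_n) // ltn_add2r.
  by left; rewrite -(subrK q f); apply: dividesD.
have dq : divides p%:P (f * q).
  have -> : f * q = f * g - f * (g - q) by rewrite mulrBr opprB addrC subrK.
  by apply: dividesB => //; apply: divides_mulr.
have [|?|dq'] := IHn f q _ dq; [|by left|].
  by rewrite -ltnS (leq_trans _ le_n) // ltn_add2l.
by right; rewrite -(subrK q g); apply: dividesD.
Qed.

Definition primitive_poly f : Prop :=
  forall c, divides c%:P f -> c \is a GRing.unit.

Hypothesis ufdD : ufd D.

Lemma irreducible_factor c : c != 0 -> c \isn't a GRing.unit ->
  exists2 p, irreducible_elt p & divides p c.
Proof.
case: ufdD => mu muP _; have [n] := ubnP (mu c).
elim: n c => // n IHn c /ltnSE le_n c0 uc.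
have [irr|] := pselect (irreducible_elt c).
  by exists c => //; exists 1; rewrite mul1r.
move=> /not_and3P[/(_ c0)//|/(_ uc)//|].
move=> /existsNP[a /existsNP[b /not_implyP[ec /not_orP[/negP ua /negP ub]]]].
have a0 : a != 0 by apply: contraNneq c0 => a0; rewrite ec a0 mul0r.
have b0 : b != 0 by apply: contraNneq c0 => b0; rewrite ec b0 mulr0.
have ltm : (mu a < mu c)%N by rewrite ltn_neqAle ec !(muP a b a0 b0) (negPf ub).
have [p ip [d ed]] := IHn a (leq_trans ltm le_n) a0 ua.
by exists p => //; exists (b * d); rewrite ec ed -[RHS]mulrA [RHS]mulrC.
Qed.

(** An irreducible factor of [c] is prime, also in [{poly D}], and cannot divide the primitive [f];
    it therefore divides the cofactor and cancels. Divisibility up to a constant, as pseudo-division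
    gives it, thus becomes divisibility. *)
Lemma primitive_cancel f g c :
  primitive_poly f -> c != 0 -> divides f (c%:P * g) -> divides f g.
Proof.
move=> prf; case: (ufdD) => mu muP primeP; have [n] := ubnP (mu c).
elim: n c => // n IHn c /ltnSE le_n c0 [h eh].
have [uc|nuc] := boolP (c \is a GRing.unit).
  by exists (c^-1%:P * h); rewrite -mulrA -eh mulrA -polyCM mulVr ?mul1r.
have [p ip [d ed]] := irreducible_factor c0 nuc.
have [p0 up _] := ip.
have d0 : d != 0 by apply: contraNneq c0 => d0; rewrite ed d0 mul0r.
have ltm : (mu d < mu c)%N by rewrite ltn_neqAle ed !(muP d p d0 p0) (negPf up).
have [[k ek]|/prf] : divides p%:P h \/ divides p%:P f.
- apply: prime_polyC => //; first exact: primeP.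
  by exists (d%:P * g); rewrite -eh ed polyCM mulrAC.
- apply: (IHn d) => //; first exact: leq_trans ltm le_n.
  exists k; apply: (@mulfI _ p%:P); first by rewrite polyC_eq0.
  have <- : c%:P * g = p%:P * (d%:P * g) by rewrite ed polyCM mulrA [p%:P * _]mulrC.
  by rewrite eh ek mulrCA mulrA [_ * p%:P]mulrC.
- by rewrite (negPf up).
Qed.

Lemma primitive_part f : f != 0 ->
  exists2 c, c != 0 & exists2 g, f = c%:P * g & primitive_poly g.
Proof.
case: ufdD => mu muP _; have [n] := ubnP (mu (lead_coef f)).
elim: n f => // n IHn f /ltnSE le_n f0.
have [prf|] := pselect (primitive_poly f).
  by exists 1; rewrite ?oner_eq0 //; exists f; rewrite ?mul1r.
move=> /existsNP[c /not_implyP[[g eg] /negP uc]].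
have c0 : c != 0 by apply: contraNneq f0 => c0; rewrite eg c0 mulr0.
have g0 : g != 0 by apply: contraNneq f0 => g0; rewrite eg g0 mul0r.
have lg0 : lead_coef g != 0 by rewrite lead_coef_eq0.
have ltm : (mu (lead_coef g) < mu (lead_coef f))%N.
  by rewrite eg lead_coefM lead_coefC ltn_neqAle !(muP _ _ lg0 c0) (negPf uc).
have [d d0 [h eh ph]] := IHn g (leq_trans ltm le_n) g0.
exists (c * d); rewrite ?mulf_neq0 //; exists h => //.
by rewrite eg eh polyCM mulrC mulrA.
Qed.

(** An irreducible [F] of positive degree is primitive. If its pseudo-gcd with [G] is constant, [F]
    divides [H] up to a constant; otherwise the primitive part of the gcd divides both, is not a
    unit, and so is associate to [F]. *)
Lemma ufd_poly : ufd {poly D}.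
Proof.
case: (ufdD) => mu muP primeP.
exists (fun f => size f + mu (lead_coef f))%N.
  move=> f g f0 g0; rewrite lead_coefM.
  have lf0 : lead_coef f != 0 by rewrite lead_coef_eq0.
  have lg0 : lead_coef g != 0 by rewrite lead_coef_eq0.
  have sg : (0 < size g)%N by rewrite size_poly_gt0.
  have [le1 eq1] := muP _ _ lf0 lg0.
  have les : (size f <= size (f * g)%R)%N.
    by rewrite size_mul // -(prednK sg) addnS leq_addr.
  split; first exact: leq_add.
  have [s1|ns1] := eqVneq (size g) 1%N.
    rewrite size_mul // s1 addn1 eqn_add2l eq1 poly_unitE s1 eqxx /=.
    by rewrite lead_coefE s1.
  rewrite poly_unitE (negPf ns1) /=; apply/negbTE; rewrite neq_ltn.
  apply/orP; left; rewrite -addSn leq_add // size_mul //.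
  by rewrite -(prednK sg) addnS -[X in (X < _)%N]addn0 ltn_add2l -ltnS prednK //
    ltn_neqAle eq_sym ns1.
move=> F [F0 uF irrF].
have [sF|sF] := leqP (size F) 1.
  have eF := size1_polyC sF; rewrite eF in F0 uF irrF *.
  rewrite polyC_eq0 in F0; apply: prime_polyC => //; apply: primeP; split=> //.
    by rewrite poly_unit_const in uF.
  move=> a b eab; have := irrF a%:P b%:P; rewrite -polyCM eab !poly_unit_const.
  exact.
have prF : primitive_poly F.
  move=> c [g eg]; case: (irrF _ _ eg); last by rewrite poly_unit_const.
  rewrite poly_unitE => /andP[/eqP sg _]; move: sF; rewrite eg.
  have := size_polyMleq g c%:P; rewrite sg add1n /= => le1 le2.
  by have := leq_trans le2 le1; rewrite size_polyC; case: eqP.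
move=> G H [K eGH].
have [->|G0] := eqVneq G 0; first by left; exists 0; rewrite mul0r.
have dvdF f g : primitive_poly f -> Pdiv.Idomain.dvdp f g -> divides f g.
  move=> prf /Pdiv.Idomain.dvdpP[[c q] /= c0 e].
  by apply: (primitive_cancel prf c0); exists q; rewrite mul_polyC.
have [cop|ncop] := boolP (Pdiv.Idomain.coprimep F G).
  right; apply: dvdF => //.
  rewrite -(Pdiv.Idomain.Gauss_dvdpr _ cop) eGH.
  exact: Pdiv.Idomain.dvdp_mull.
left; set d := Pdiv.Idomain.gcdp F G in ncop.
have d0 : d != 0 by rewrite Pdiv.Idomain.gcdp_eq0 negb_and F0.
have [c c0 [e ed pre]] := primitive_part d0.
have e_d : Pdiv.Idomain.dvdp e d by rewrite ed Pdiv.Idomain.dvdp_mull.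
have [k ek] : divides e F.
  by apply: dvdF => //; apply: Pdiv.Idomain.dvdp_trans e_d _;
    rewrite Pdiv.Idomain.dvdp_gcdl.
have [l el] : divides e G.
  by apply: dvdF => //; apply: Pdiv.Idomain.dvdp_trans e_d _;
    rewrite Pdiv.Idomain.dvdp_gcdr.
case: (irrF _ _ ek) => [uk|ue].
  by exists (l * k^-1); rewrite el ek mulrA mulrVK.
case/negP: ncop; rewrite /Pdiv.Idomain.coprimep -/d ed.
move: ue; rewrite poly_unitE => /andP[/eqP se _].
by rewrite mul_polyC size_scale ?se.
Qed.

(* The generator is a primitive element of least degree. *)
Lemma prime_ideal_principal (J : {poly D} -> Prop) :
  (forall f g, J f -> J g -> J (f - g)) -> (forall f g, J f -> J (g * f)) ->
  (forall f g, J (f * g) -> J f \/ J g) -> (forall c, J c%:P -> c = 0) ->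
  (exists2 f, J f & f != 0) ->
  exists F, [/\ J F, F != 0 & forall g, J g -> divides F g].
Proof.
move=> JB JM Jp JC [f Jf f0].
have : exists n, `[< exists f, [/\ J f, f != 0 & size f = n] >].
  by exists (size f); apply/asboolP; exists f.
move=> exn; case: (ex_minnP exn) => n /asboolP[f1 [Jf1 f1n0 sf1]] minn.
have [c c0 [F eF prF]] := primitive_part f1n0.
(* Primality splits [c * F], and [J] contains no nonzero constant. *)
have JF : J F.
  by move: Jf1; rewrite eF => /Jp[/JC c1|//]; rewrite c1 eqxx in c0.
have F0 : F != 0 by apply: contraNneq f1n0 => F0; rewrite eF F0 mulr0.
have sF : size F = n by rewrite -sf1 eF mul_polyC size_scale.
exists F; split=> // g Jg.
have := Pdiv.Idomain.divp_eq g F.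
set k := Pdiv.Idomain.scalp g F; set q := _ %/ F; set r := _ %% F => er.
have l0 : lead_coef F ^+ k != 0 by rewrite expf_neq0 // lead_coef_eq0.
have Jr : J r.
  have -> : r = (lead_coef F ^+ k)%:P * g - q * F by rewrite mul_polyC er addrC addKr.
  by apply: JB; apply: JM.
have r0 : r = 0.
  apply/eqP; apply: contraT => r0.
  have /minn : `[< exists f, [/\ J f, f != 0 & size f = size r] >].
    by apply/asboolP; exists r.
  by rewrite leqNgt -sF Pdiv.Idomain.ltn_modp F0.
apply: (primitive_cancel prF l0); exists q.
by rewrite mul_polyC er r0 addr0.
Qed.

End UFDPoly.

(** * Isolating one variable of a multivariate polynomial *)

Section Morphisms.
Variables (n : nat) (R : comNzRingType) (S : nzRingType).

Lemma mpoly_morph_eq (f g : {rmorphism {mpoly R[n]} -> S}) :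
  (forall c, f c%:MP = g c%:MP) -> (forall i, f 'X_i = g 'X_i) -> f =1 g.
Proof.
move=> eC eX p; rewrite [p]mpolyE !rmorph_sum; apply: eq_bigr => m _.
rewrite -mul_mpolyC !rmorphM eC; congr (_ * _).
rewrite mpolyXE_id !rmorph_prod; apply: eq_bigr => i _.
by rewrite !rmorphXn eX.
Qed.
End Morphisms.

Section Uni.
Variables (n : nat) (R : idomainType) (i : 'I_n.+1).

Definition mpoly_uni_var (j : 'I_n.+1) : {poly {mpoly R[n]}} :=
  if unlift i j is Some j' then ('X_j')%:P else 'X.

Definition mpoly_uni : {mpoly R[n.+1]} -> {poly {mpoly R[n]}} :=
  mmap (polyC \o @mpolyC n R) mpoly_uni_var.

HB.instance Definition _ := GRing.RMorphism.on mpoly_uni.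

Definition mpoly_lift : {mpoly R[n]} -> {mpoly R[n.+1]} :=
  comp_mpoly [tuple 'X_(lift i j) | j < n].

HB.instance Definition _ := GRing.RMorphism.on mpoly_lift.

Definition mpoly_of_uni (p : {poly {mpoly R[n]}}) : {mpoly R[n.+1]} :=
  (map_poly mpoly_lift p).['X_i].

Lemma mpoly_of_uni_is_zmod : zmod_morphism mpoly_of_uni.
Proof. by move=> p q; rewrite /mpoly_of_uni rmorphB hornerD hornerN. Qed.
Lemma mpoly_of_uni_is_monoid : monoid_morphism mpoly_of_uni.
Proof.
by split=> [|p q]; rewrite /mpoly_of_uni ?rmorph1 ?hornerC // rmorphM hornerM.
Qed.
HB.instance Definition _ := GRing.isZmodMorphism.Build _ _ _ mpoly_of_uni_is_zmod.
HB.instance Definition _ := GRing.isMonoidMorphism.Build _ _ _ mpoly_of_uni_is_monoid.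

Lemma mpoly_of_uniC c : mpoly_of_uni c%:P = mpoly_lift c.
Proof. by rewrite /mpoly_of_uni map_polyC hornerC. Qed.

Lemma mpoly_of_uniX : mpoly_of_uni 'X = 'X_i.
Proof. by rewrite /mpoly_of_uni map_polyX hornerX. Qed.

Lemma mpoly_uniK : cancel mpoly_uni mpoly_of_uni.
Proof.
pose f : {rmorphism {mpoly R[n.+1]} -> {mpoly R[n.+1]}} := mpoly_of_uni \o mpoly_uni.
apply: (@mpoly_morph_eq _ _ _ f idfun) => [c|j] /=.
  by rewrite /mpoly_uni mmapC mpoly_of_uniC /mpoly_lift comp_mpolyC.
rewrite /mpoly_uni mmapX mmap1U /mpoly_uni_var; case: unliftP => [k ->|->].
  by rewrite mpoly_of_uniC /mpoly_lift comp_mpolyXU -tnth_nth tnth_mktuple.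
exact: mpoly_of_uniX.
Qed.

Lemma mpoly_uni_lift c : mpoly_uni (mpoly_lift c) = c%:P.
Proof.
pose f : {rmorphism {mpoly R[n]} -> {poly {mpoly R[n]}}} := mpoly_uni \o mpoly_lift.
apply: (@mpoly_morph_eq _ _ _ f polyC) => [d|j] /=.
  by rewrite /mpoly_lift comp_mpolyC /mpoly_uni mmapC.
rewrite /mpoly_lift comp_mpolyXU -tnth_nth tnth_mktuple /mpoly_uni mmapX mmap1U.
by rewrite /mpoly_uni_var liftK.
Qed.

Lemma mpoly_uniX : mpoly_uni 'X_i = 'X.
Proof. by rewrite /mpoly_uni mmapX mmap1U /mpoly_uni_var unlift_none. Qed.

Lemma mpoly_of_uniK : cancel mpoly_of_uni mpoly_uni.
Proof.
move=> p; rewrite -[p]coefK poly_def !rmorph_sum /=; apply: eq_bigr => j _.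
rewrite -mul_polyC !rmorphM !rmorphXn /= mpoly_of_uniC mpoly_of_uniX.
by rewrite mpoly_uni_lift mpoly_uniX.
Qed.

Lemma meval_lift v c : (mpoly_lift c).@[v] = c.@[fun j => v (lift i j)].
Proof.
rewrite /mpoly_lift comp_mpoly_meval; apply: meval_eq => j.
by rewrite tnth_mktuple mevalXU.
Qed.

Lemma meval_of_uni v p :
  (mpoly_of_uni p).@[v] = (map_poly (meval (fun j => v (lift i j))) p).[v i].
Proof.
rewrite -[p]coefK poly_def !rmorph_sum /= horner_sum; apply: eq_bigr => j _.
rewrite -mul_polyC !rmorphM !rmorphXn /= mpoly_of_uniC mpoly_of_uniX.
by rewrite mevalXU meval_lift map_polyC map_polyX hornerM hornerXn hornerC.
Qed.
End Uni.

Lemma ufd_iso (D E : idomainType) (f : {rmorphism D -> E}) (g : {rmorphism E -> D}) :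
  cancel f g -> cancel g f -> ufd D -> ufd E.
Proof.
move=> fK gK [mu muP primeP].
have unitg a : (g a \is a GRing.unit) = (a \is a GRing.unit).
  by apply/idP/idP => [/(rmorph_unit f)|/(rmorph_unit g)//]; rewrite gK.
have g0 a : (g a == 0) = (a == 0) by rewrite -(inj_eq (can_inj gK)) rmorph0.
exists (mu \o g) => [a b a0 b0 /=|p [p0 up irr] a b [c e]].
  by rewrite rmorphM -unitg; apply: muP; rewrite g0.
have irrp : irreducible_elt (g p).
  split; rewrite ?g0 ?unitg // => x y exy; rewrite -[x]fK -[y]fK !unitg.
  by apply: irr; rewrite -rmorphM -exy gK.
case: (primeP _ irrp (g a) (g b)) => [||].
- by exists (g c); rewrite -!rmorphM e.
- by move=> [d ed]; left; exists (f d); rewrite -[a]gK ed rmorphM gK.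
- by move=> [d ed]; right; exists (f d); rewrite -[b]gK ed rmorphM gK.
Qed.

Lemma ufd_mpoly (K : fieldType) n : ufd {mpoly K[n]}.
Proof.
elim: n => [|n IHn].
  have unit0 (a : {mpoly K[0]}) : (a \is a GRing.unit) = (a != 0).
    apply/idP/idP => [ua|a0]; first by apply: contraTneq ua => ->; rewrite unitr0.
    rewrite (nvar0_mpolyC a) in a0 *; rewrite mpolyC_eq0 in a0.
    by apply/unitrP; exists (a@_0)^-1%:MP; rewrite -!mpolyCM mulVf ?mulfV.
  exists (fun=> 0%N) => [a b a0 b0|p [p0]].
    by rewrite unit0 b0; apply/leqifP.
  by rewrite unit0 p0.
exact: (ufd_iso (@mpoly_of_uniK _ _ ord_max) (@mpoly_uniK _ _ ord_max) (ufd_poly IHn)).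
Qed.

(** The integers 0, ..., [size p - 1], distinct in characteristic 0, are too many to be all
    roots. *)
Lemma poly_neq0_eval (R : idomainType) (p : {poly R}) :
  [pchar R] =i pred0 -> p != 0 -> exists x, p.[x] != 0.
Proof.
move=> ch0 p0; apply: contrapT => /forallNP vanish.
pose s := [seq (k%:R : R) | k <- iota 0 (size p)].
have := @max_poly_roots _ p s p0; rewrite size_map size_iota ltnn => H.
suff : false by []; apply: H.
  apply/allP => _ /mapP[k _ ->]; rewrite rootE; apply/eqP; apply: contrapT => /eqP.
  exact: vanish.
rewrite map_inj_uniq ?iota_uniq // => a b eab; apply/eqP.
wlog le_ab : a b eab / (a <= b)%N.
  by move=> H2; case: (leqP a b) => [/H2->//|/ltnW/H2]; rewrite eq_sym => ->.
move/eqP: eab; rewrite eq_sym -subr_eq0 -natrB // (pcharf0P _).1 //.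
by rewrite subn_eq0 eqn_leq le_ab => ->.
Qed.

Lemma mpoly_neq0_eval (R : idomainType) n (p : {mpoly R[n]}) :
  [pchar R] =i pred0 -> p != 0 -> exists v, p.@[v] != 0.
Proof.
move=> ch0; elim: n p => [|n IHn] p p0.
  by exists (fun=> 0); move: p0; rewrite (nvar0_mpolyC p) mevalC mpolyC_eq0.
pose q := mpoly_uni ord_max p.
have q0 : q != 0.
  by apply: contraNneq p0 => q0; rewrite -[p](mpoly_uniK ord_max) -/q q0 rmorph0.
have [v lv] : exists v, (lead_coef q).@[v] != 0 by apply: IHn; rewrite lead_coef_eq0.
have qv0 : map_poly (meval v) q != 0.
  by apply: contraNneq lv => q1; rewrite -coef_map q1 coef0.
have [x qx] := poly_neq0_eval ch0 qv0.
exists (fun j => if unlift ord_max j is Some j' then v j' else x).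
rewrite -[p](mpoly_uniK ord_max) meval_of_uni -/q unlift_none.
rewrite (_ : map_poly _ q = map_poly (meval v) q) //.
by apply: eq_map_poly => c /=; apply: meval_eq => j; rewrite liftK.
Qed.

Lemma mpoly_eval_inj (R : idomainType) n (p q : {mpoly R[n]}) :
  [pchar R] =i pred0 -> (forall v, p.@[v] = q.@[v]) -> p = q.
Proof.
move=> ch0 e; apply/eqP; rewrite -subr_eq0; apply: contraT => /(mpoly_neq0_eval ch0)[v].
by rewrite mevalB e subrr eqxx.
Qed.

(** The condition on [mpoly_lift i] stands in for height one: seen as univariate in [X_i], the ideal
    contains no nonzero constant. *)
Lemma mpoly_prime_ideal_principal (K : fieldType) n (i : 'I_n.+1)
    (I : {mpoly K[n.+1]} -> Prop) :
  (forall f g, I f -> I g -> I (f - g)) -> (forall f g, I f -> I (g * f)) ->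
  (forall f g, I (f * g) -> I f \/ I g) ->
  (forall c, I (mpoly_lift i c) -> c = 0) -> (exists2 f, I f & f != 0) ->
  exists F, [/\ I F, F != 0 & forall g, I g -> divides F g].
Proof.
move=> IB IM Ip IC [f If f0].
have [] := @prime_ideal_principal _ (ufd_mpoly K n) (fun p => I (mpoly_of_uni i p)).
- by move=> p q Jp Jq; rewrite rmorphB; apply: IB.
- by move=> p q Jp; rewrite rmorphM; apply: IM.
- by move=> p q; rewrite rmorphM; apply: Ip.
- by move=> c; rewrite mpoly_of_uniC; apply: IC.
- exists (mpoly_uni i f); rewrite ?mpoly_uniK //.
  by apply: contraNneq f0 => e; rewrite -[f](mpoly_uniK i) e rmorph0.
move=> F [JF F0 gen]; exists (mpoly_of_uni i F); split=> //.
  by apply: contraNneq F0 => e; rewrite -[F](mpoly_of_uniK i) e rmorph0.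
move=> g; rewrite -[g](mpoly_uniK i) => /gen[h ->].
by exists (mpoly_of_uni i h); rewrite rmorphM.
Qed.

(** * Nullstellensatz over an uncountable field *)

(* Equivalently, [T] is not a countable union of finite sets. *)
Definition uncountable_type (T : eqType) : Prop :=
  forall m : T -> nat, exists D, forall N, exists s : seq T,
    [/\ uniq s, size s = N & forall a, a \in s -> m a = D].

Definition is_ideal (R : nzRingType) (J : R -> Prop) : Prop :=
  [/\ J 0, forall f g, J f -> J g -> J (f + g) & forall f g, J f -> J (g * f)].

Section Nullstellensatz.
Variables (K : closedFieldType) (n : nat).
Hypothesis uncK : uncountable_type K.
Implicit Types (J : {mpoly K[n]} -> Prop) (f g h : {mpoly K[n]}).

Lemma ideal_sum J (T : Type) (s : seq T) (P : pred T) (F : T -> {mpoly K[n]}) :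
  is_ideal J -> (forall t, P t -> J (F t)) -> J (\sum_(t <- s | P t) F t).
Proof. by case=> J0 JD _ JF; apply: big_ind. Qed.

Lemma idealN J f : is_ideal J -> J f -> J (- f).
Proof. by case=> _ _ JM Jf; rewrite -mulN1r; apply: (JM). Qed.

Lemma idealB J f g : is_ideal J -> J f -> J g -> J (f - g).
Proof. by move=> idJ Jf Jg; case: (idJ) => _ JD _; apply: (JD) => //; apply: idealN. Qed.

Lemma lindep_bounded (D N : nat) (h : 'I_N -> {mpoly K[n]}) :
  (#|{: 'X_{1..n < D}}| < N)%N -> (forall j, msize (h j) <= D)%N ->
  exists2 l : 'rV[K]_N, l != 0 & \sum_j l 0 j *: h j = 0.
Proof.
move=> ltN leD.
pose C := \matrix_(j < N, m < #|{: 'X_{1..n < D}}|) (h j)@_(enum_val m).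
have : kermx C != 0.
  rewrite kermx_eq0 -row_leq_rank -ltnNge; apply: leq_ltn_trans ltN.
  exact: rank_leq_col.
move=> /rowV0Pn[l /sub_kermxP lC l0]; exists l => //.
apply/mpolyP => m; rewrite mcoeff0 raddf_sum /=.
have [ltm|gem] := ltnP (mdeg m) D.
  have := congr1 (fun u : 'rV_ _ => u 0 (enum_rank (BMultinom ltm))) lC.
  rewrite !mxE => e; rewrite -[RHS]e; apply: eq_bigr => j _.
  by rewrite mcoeffZ !mxE enum_rankK.
apply: big1 => j _; rewrite mcoeffZ memN_msupp_eq0 ?mulr0 //.
exact: msize_mdeg_ge (leq_trans (leD j) gem).
Qed.

(* Were all the [x_i - a] invertible modulo [J], uncountably many of their inverses
   would have bounded degree, hence be linearly dependent, and clearing denominators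
   would put a nonzero polynomial in [x_i] in [J]. *)
Lemma ideal_add_linear_proper J i : is_ideal J -> ~ J 1 ->
  exists a, ~ exists h, J (1 - h * ('X_i - a%:MP)).
Proof.
move=> idJ J1; case: (idJ) => J0 JD JM; apply: contrapT => /forallNP all_inv.
have /choice[h hP] : forall a, exists h, J (1 - h * ('X_i - a%:MP)).
  by move=> a; apply: contrapT => /(all_inv a).
have [D /(_ #|{: 'X_{1..n < D}}|.+1)[s [us ss ms]]] := uncK (fun a => msize (h a)).
set N := _.+1 in ss.
pose a_ (j : 'I_N) := s`_j.
have inj_a : injective a_.
  move=> j k /eqP; rewrite /a_ nth_uniq ?ss ?ltn_ord // => /eqP; exact: val_inj.
have [|j|l l0 le] := @lindep_bounded D N (fun j => h (a_ j)); first exact: ltnSn.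
  by rewrite ms // mem_nth // ss.
pose iota (q : {poly K}) : {mpoly K[n]} := (map_poly (@mpolyC n K) q).['X_i].
have iotaM p q : iota (p * q) = iota p * iota q by rewrite /iota rmorphM hornerM.
have iotaXC a : iota ('X - a%:P) = 'X_i - a%:MP.
  by rewrite /iota rmorphB /= map_polyX map_polyC hornerXsubC.
have iota1 : iota 1 = 1 by rewrite /iota rmorph1 hornerC.
have iotaC c : iota c%:P = c%:MP by rewrite /iota map_polyC hornerC.
(* Numerator of the sum of the [l_j / (X - a_j)]; at [a_j] it takes the value [l_j] times a nonzero
   product, so it is not zero. *)
pose q := \sum_j l 0 j *: \prod_(k | k != j) ('X - (a_ k)%:P).
have q0 : q != 0.
  have /rV0Pn[j lj] := l0.
  suff : q.[a_ j] != 0 by apply: contraNneq => ->; rewrite horner0.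
  rewrite horner_sum (bigD1 j) //= [X in _ + X]big1 => [|k kj].
    rewrite addr0 hornerZ mulf_neq0 // horner_prod; apply/prodf_neq0 => k kj.
    by rewrite hornerXsubC subr_eq0 (inj_eq inj_a) eq_sym.
  rewrite hornerZ horner_prod (bigD1 j) 1?eq_sym //=.
  by rewrite hornerXsubC subrr mul0r mulr0.
have Jq : J (iota q).
  pose full := \prod_k ('X_i - (a_ k)%:MP) : {mpoly K[n]}.
  have iotaP (P : pred 'I_N) : iota (\prod_(k | P k) ('X - (a_ k)%:P)) =
      \prod_(k | P k) ('X_i - (a_ k)%:MP).
    rewrite /iota rmorph_prod horner_prod; apply: eq_bigr => k _.
    exact: iotaXC.
  have -> : iota q = \sum_j (l 0 j)%:MP * \prod_(k | k != j) ('X_i - (a_ k)%:MP)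
              - (\sum_j l 0 j *: h (a_ j)) * full.
    rewrite le mul0r subr0 /q /iota rmorph_sum horner_sum; apply: eq_bigr => j _.
    by rewrite -mul_polyC -/(iota _) iotaM iotaC iotaP.
  rewrite mulr_suml -sumrB; apply: ideal_sum => // j _.
  have -> : full = ('X_i - (a_ j)%:MP) * \prod_(k | k != j) ('X_i - (a_ k)%:MP).
    by rewrite /full (bigD1 j).
  rewrite -mul_mpolyC -!mulrA -mulrBr mulrA; apply: (JM).
  by rewrite -[X in X - _]mul1r -mulrBl mulrC; apply: (JM).
have Jprod (t : seq K) : exists H, J (1 - H * \prod_(b <- t) ('X_i - b%:MP)).
  elim: t => [|b t [H JH]]; first by exists 1; rewrite big_nil mulr1 subrr.
  exists (h b * H); rewrite big_cons; set u := 'X_i - b%:MP; set v := \prod_(j <- t) ('X_i - j%:MP).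
  have -> : 1 - h b * H * (u * v) = (1 - h b * u) + h b * u * (1 - H * v).
    by rewrite [_ * (1 - _)]mulrBr mulr1 addrA subrK mulrACA.
  by apply: (JD); [exact: hP|exact: (JM)].
(* [q] splits into linear factors, each invertible modulo [J], while [iota q] is in [J]; so 1 would
   be in [J]. *)
have [t et] := closed_field_poly_normal q.
have [H JH] := Jprod t.
case: J1; rewrite -[1](subrK (H * \prod_(b <- t) ('X_i - b%:MP))); apply: (JD) => //.
apply: (JM).
have -> : \prod_(b <- t) ('X_i - b%:MP) = (lead_coef q)^-1%:MP * iota q.
  rewrite [in RHS]et -mul_polyC iotaM iotaC mulrA -mpolyCM lead_coefM lead_coefC.
  rewrite (_ : lead_coef (\prod_(z <- t) ('X - z%:P)) = 1); last exact/monicP/monic_prod_XsubC.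
  rewrite mulr1 mulVf ?lead_coef_eq0 // mpolyC1 mul1r /iota rmorph_prod horner_prod.
  by apply: eq_bigr => b _; rewrite -iotaXC.
exact: (JM).
Qed.

Lemma ideal_add_linears_proper (s : seq 'I_n) J : is_ideal J -> ~ J 1 ->
  exists J', [/\ is_ideal J', forall f, J f -> J' f, ~ J' 1 &
    forall i, i \in s -> exists a, J' ('X_i - a%:MP)].
Proof.
move=> idJ J1; elim: s => [|i s [J' [idJ' sJ J'1 lin]]]; first by exists J.
have [a na] := ideal_add_linear_proper i idJ' J'1; case: (idJ') => J0 JD JM.
exists (fun f => exists h, J' (f - h * ('X_i - a%:MP))); split=> //.
- split; first by exists 0; rewrite mul0r subrr.
    move=> f g [h Jh] [k Jk]; exists (h + k).
    by rewrite mulrDl opprD addrACA; apply: (JD).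
  by move=> f g [h Jh]; exists (g * h); rewrite -mulrA -mulrBr; apply: (JM).
- by move=> f Jf; exists 0; rewrite mul0r subr0; apply: sJ.
- move=> j; rewrite inE => /orP[/eqP ->|js].
    by exists a, 1; rewrite mul1r subrr.
  by have [b Jb] := lin j js; exists b, 0; rewrite mul0r subr0.
Qed.

(** Once some [X_i - v_i] is adjoined for every variable, each [f] is congruent to the constant
    [f.@[v]], which must vanish for [f] in [J] since the enlarged ideal is still proper. *)
Lemma weak_nullstellensatz J : is_ideal J -> ~ J 1 ->
  exists v, forall f, J f -> f.@[v] = 0.
Proof.
move=> idJ J1.
have [J' [idJ' sJ J'1 lin]] := ideal_add_linears_proper (enum 'I_n) idJ J1.
case: (idJ') => J0 JD JM.
have /choice[v vP] : forall i, exists a, J' ('X_i - a%:MP).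
  by move=> i; apply: lin; rewrite mem_enum.
have Jev f : J' (f - (f.@[v])%:MP).
  have JevM g h : J' (g - (g.@[v])%:MP) -> J' (h - (h.@[v])%:MP) ->
      J' (g * h - ((g * h).@[v])%:MP).
    move=> Jg Jh; rewrite mevalM mpolyCM.
    have -> : g * h - (g.@[v])%:MP * (h.@[v])%:MP =
       h * (g - (g.@[v])%:MP) + (g.@[v])%:MP * (h - (h.@[v])%:MP).
      by rewrite !mulrBr addrA [h * _%:MP]mulrC subrK [h * g]mulrC.
    by apply: (JD); apply: (JM).
  elim/mpolyind: f => [|c m p _ _ IHp]; first by rewrite meval0 mpolyC0 subrr.
  rewrite mevalD mpolyCD opprD addrACA; apply: (JD) => //.
  rewrite -mul_mpolyC; apply: (JevM); first by rewrite mevalC subrr.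
  rewrite mpolyXE_id; elim/big_ind: _ => [||i _].
  - by rewrite meval1 mpolyC1 subrr.
  - exact: (JevM).
  - elim: (m i) => [|k IHk]; first by rewrite expr0 meval1 mpolyC1 subrr.
    by rewrite exprS; apply: (JevM) => //; rewrite mevalXU.
exists v => f Jf; apply/eqP; apply: contrapT => /negP fv.
case: J'1; have -> : 1 = (f.@[v])^-1%:MP * (f.@[v])%:MP :> {mpoly K[n]}.
  by rewrite -mpolyCM mulVf // mpolyC1.
apply: (JM); rewrite -[_%:MP](subKr f); apply: idealB => //; exact: sJ.
Qed.

End Nullstellensatz.

(** * Linear sections of a cone *)

Section Homogeneous.
Variables (R : comNzRingType) (n : nat).
Implicit Types (f g : {mpoly R[n]}).

Lemma pihomogM k b f g : f \is k.-homog ->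
  pihomog mdeg (k + b)%N (f * g) = f * pihomog mdeg b g.
Proof.
move=> hf; elim/mpolyind: g => [|c m g _ _ IHg]; first by rewrite mulr0 !pihomog0 mulr0.
rewrite mulrDr !linearD /= mulrDr IHg -scalerAr !linearZ -scalerAr /=; congr (_ *: _ + _).
rewrite pihomogX; have hX : f * 'X_[m] \is (k + mdeg m)%N.-homog.
  by apply: dhomogM => //; rewrite dhomogX.
case: eqP => [<-|/eqP ne]; first by rewrite pihomog_dE.
rewrite (@pihomog_ne0 _ _ _ (k + mdeg m)%N (k + b)%N) ?eqn_add2l //.
by rewrite mulr0.
Qed.

Lemma pihomogM0 k d f g : f \is k.-homog -> (d < k)%N ->
  pihomog mdeg d (f * g) = 0.
Proof.
move=> hf lt; elim/mpolyind: g => [|c m g _ _ IHg]; first by rewrite mulr0 pihomog0.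
rewrite mulrDr linearD /= IHg addr0 -scalerAr linearZ /=.
have hX : f * 'X_[m] \is (k + mdeg m)%N.-homog by apply: dhomogM => //; rewrite dhomogX.
rewrite (@pihomog_ne0 _ _ _ (k + mdeg m)%N d) ?scaler0 // gtn_eqF //.
exact: leq_trans lt (leq_addr _ _).
Qed.

Lemma pihomog_big d f : (msize f <= d)%N -> pihomog mdeg d f = 0.
Proof.
move=> le; rewrite pihomogE big_seq_cond big1 // => m /andP[mf /eqP md].
by have := msize_mdeg_lt mf; rewrite md ltnNge le.
Qed.

Lemma comp_homogX k e (w : n.-tuple {mpoly R[k]}) m :
  (forall i, tnth w i \is e.-homog) -> 'X_[m] \mPo w \is (e * mdeg m)%N.-homog.
Proof.
move=> hw; rewrite comp_mpolyX mdegE big_distrr /=.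
elim/big_rec2: _ => [|i d q _ IH]; first exact: dhomog1.
by apply: dhomogM IH; apply: dhomogMn.
Qed.

(** Composition with forms of degree [e] sends degree [d] to [e * d]; as [e > 0], distinct degrees
    stay distinct. Hence the kernel of composition with [w], the ideal of the cone, is
    homogeneous. *)
Lemma pihomog_comp k e (w : n.-tuple {mpoly R[k]}) d f :
  (0 < e)%N -> (forall i, tnth w i \is e.-homog) ->
  pihomog mdeg d f \mPo w = pihomog mdeg (e * d)%N (f \mPo w).
Proof.
move=> e0 hw; elim/mpolyind: f => [|c m f _ _ IHf]; first by rewrite !(pihomog0, comp_mpoly0).
rewrite linearD /= !comp_mpolyD linearD /= IHf; congr (_ + _).
rewrite linearZ /= !comp_mpolyZ linearZ /= pihomogX; congr (_ *: _).
have hX := comp_homogX m hw.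
case: eqP => [<-|/eqP ne]; first by rewrite pihomog_dE.
by rewrite comp_mpoly0 (@pihomog_ne0 _ _ _ (e * mdeg m)%N (e * d)%N) // eqn_pmul2l.
Qed.
End Homogeneous.

Definition linear_form (R : nzRingType) (r M : nat) (Q : 'M[R]_(r, M)) (t : 'I_r) :
    {mpoly R[M]} := \sum_i Q t i *: 'X_i.

Section Cone.
Variables (K : closedFieldType) (p M e : nat) (w : M.-tuple {mpoly K[p]}).
Hypothesis uncK : uncountable_type K.
Hypothesis e_gt0 : (0 < e)%N.
Hypothesis w_homog : forall i, tnth w i \is e.-homog.

Definition cone_point (y : 'I_p -> K) : 'cV[K]_M := \col_i (tnth w i).@[y].

(** The condition is on the image point: under Y |-> Y^T Y a nonzero [y] may be sent to the
    vertex. *)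
Definition meets_cone (r : nat) (Q : 'M[K]_(r, M)) : Prop :=
  exists2 y, cone_point y != 0 & Q *m cone_point y = 0.

Hypothesis w_closed : forall x : 'I_M -> K,
  (forall g : {mpoly K[M]}, g \mPo w = 0 -> g.@[x] = 0) ->
  exists y, forall i, x i = (tnth w i).@[y].

Lemma linear_form_homog (r : nat) (Q : 'M[K]_(r, M)) t :
  linear_form Q t \is 1.-homog.
Proof.
by apply: rpred_sum => i _; apply: rpredZ; rewrite dhomogX /= mdeg1.
Qed.

Lemma meval_linear_form (r : nat) (Q : 'M[K]_(r, M)) t x :
  (linear_form Q t).@[x] = (Q *m \col_i x i) t 0.
Proof.
rewrite /linear_form raddf_sum /= mxE; apply: eq_bigr => i _.
by rewrite mevalZ mevalXU mxE.
Qed.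

(** Projective Nullstellensatz on the cone: its coordinate ring is [{mpoly K[M]}] modulo the kernel
    of [\mPo w], and there linear forms whose only common zero is the vertex generate every form of
    large degree. *)
Lemma linear_forms_irrelevant (r : nat) (Q : 'M[K]_(r, M)) : ~ meets_cone Q ->
  exists m, forall d (f : {mpoly K[M]}), (m <= d)%N -> f \is d.+1.-homog ->
    exists2 h : 'I_r -> {mpoly K[M]}, forall t, h t \is d.-homog &
      f \mPo w = (\sum_t linear_form Q t * h t) \mPo w.
Proof.
move=> nQ.
pose J (f : {mpoly K[M]}) := exists h, (f - \sum_t linear_form Q t * h t) \mPo w = 0.
have idJ : is_ideal J.
  split.
  - by exists (fun=> 0); rewrite big1 ?subr0 ?comp_mpoly0 // => t _; rewrite mulr0.
  - move=> f g [h hf] [k kg]; exists (fun t => h t + k t).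
    under eq_bigr do rewrite mulrDr.
    by rewrite big_split opprD addrACA comp_mpolyD hf kg addr0.
  - move=> f g [h hf]; exists (fun t => g * h t).
    under eq_bigr do rewrite mulrCA.
    by rewrite -mulr_sumr -mulrBr rmorphM /= hf mulr0.
have [J0 JD JM] := idJ.
have Jpi d f : J f -> J (pihomog mdeg d f).
  case=> h hf; case: d => [|d].
    exists (fun=> 0); rewrite big1 => [|t _]; last by rewrite mulr0.
    rewrite subr0 (pihomog_comp _ _ e_gt0 w_homog).
    move/eqP: hf; rewrite comp_mpolyB subr_eq0 => /eqP ->.
    rewrite -(pihomog_comp _ _ e_gt0 w_homog).
    have -> : pihomog mdeg 0 (\sum_t linear_form Q t * h t) = 0; last exact: comp_mpoly0.
    rewrite (raddf_sum (pihomog mdeg 0)); apply: big1 => t _.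
    exact: (pihomogM0 _ (linear_form_homog Q t)).
  exists (fun t => pihomog mdeg d (h t)).
  have -> : \sum_t linear_form Q t * pihomog mdeg d (h t) =
      pihomog mdeg d.+1 (\sum_t linear_form Q t * h t).
    rewrite (raddf_sum (pihomog mdeg d.+1)); apply: eq_bigr => t _.
    by rewrite -add1n; apply/esym; exact: (pihomogM d (h t) (linear_form_homog Q t)).
  by rewrite -linearB /= (pihomog_comp _ _ e_gt0 w_homog) hf pihomog0.
have JX i : exists d, J ('X_i ^+ d).
  (* A common zero of [J] and [X_i - 1] would be a nonzero point of the cone killed by [Q]; so
     [c * (X_i - 1)] is congruent to 1 for some [c]. *)
  pose Ji f := exists c, J (f - c * ('X_i - 1)).
  have idJi : is_ideal Ji.
    split; first by exists 0; rewrite mul0r subrr.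
      move=> f g [h Jh] [k Jk]; exists (h + k).
      by rewrite mulrDl opprD addrACA; apply: JD.
    by move=> f g [h Jh]; exists (g * h); rewrite -mulrA -mulrBr; apply: (JM).
  have [c Jc] : Ji 1.
    apply: contrapT => /(weak_nullstellensatz uncK idJi)[x xP].
    have xP' f : J f -> f.@[x] = 0.
      by move=> Jf; apply: xP; exists 0; rewrite mul0r subr0.
    have [y yP] : exists y, forall i, x i = (tnth w i).@[y].
      apply: w_closed => g gw; apply: xP'; exists (fun=> 0).
      by rewrite big1 ?subr0 // => t _; rewrite mulr0.
    have ey : \col_i x i = cone_point y by apply/colP => j; rewrite !mxE.
    case: nQ; exists y.
      apply/eqP => y0; have : ('X_i - 1 : {mpoly K[M]}).@[x] = 0.
        by apply: xP; exists 1; rewrite mul1r subrr.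
      move/colP: y0 => /(_ i); rewrite !mxE -yP mevalB mevalXU meval1 => ->.
      by move/eqP; rewrite sub0r oppr_eq0 oner_eq0.
    apply/colP => t; rewrite -ey -meval_linear_form mxE; apply: xP'.
    exists (fun t' => (t' == t)%:R); rewrite (bigD1 t) //= big1 => [|k kt].
      by rewrite eqxx mulr1 addr0 subrr comp_mpoly0.
    by rewrite (negPf kt) mulr0.
  have hXi : ('X_i : {mpoly K[M]}) \is 1.-homog by rewrite dhomogX /= mdeg1.
  (* Comparing degrees, the component of degree [d] of [c] is congruent to [- X_i ^+ d]; it is zero
     for large [d], which puts a power of [X_i] in [J]. *)
  have step d : J ('X_i ^+ d + pihomog mdeg d c).
    elim: d => [|d IHd].
      have := Jpi 0%N _ Jc; rewrite mulrBr mulr1 opprB addrCA linearD linearB /=.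
      rewrite mulrC (pihomogM0 _ hXi) // subr0 addrC expr0.
      by rewrite pihomog_dE ?dhomog1.
    have -> : 'X_i ^+ d.+1 + pihomog mdeg d.+1 c =
       'X_i * ('X_i ^+ d + pihomog mdeg d c) + pihomog mdeg d.+1 (1 - c * ('X_i - 1)).
      have eX : pihomog mdeg d.+1 (c * 'X_i) = 'X_i * pihomog mdeg d c.
        by rewrite mulrC -add1n; exact: pihomogM.
      rewrite mulrBr mulr1 opprB addrCA linearD linearB /= eX.
      rewrite (@pihomog_ne0 _ _ _ 0%N d.+1 1) ?dhomog1 // sub0r.
      by rewrite mulrDr -exprS -addrA; congr (_ + _); rewrite addrC subrK.
    by apply: JD; [exact: (JM)|exact: Jpi].
  by exists (msize c); rewrite -[X in J X]addr0 -(pihomog_big (leqnn (msize c))).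
have [d_ dP] := choice JX.
(* A monomial of degree above the sum of the [d_ i] has some exponent at least [d_ i]. *)
exists (\sum_i d_ i)%N => d f le_d hf.
have [h hP] : J f.
  rewrite [f]mpolyE big_seq_cond; apply: ideal_sum => // m /andP[mf _].
  rewrite -mul_mpolyC; apply: (JM).
  have [i le_i] : exists i, (d_ i <= m i)%N.
    apply: contrapT => /forallNP lt.
    have : (mdeg m <= \sum_i d_ i)%N.
      by rewrite mdegE; apply: leq_sum => i _; rewrite ltnW // ltnNge; apply/negP/lt.
    by rewrite (dhomog_mf hf mf) leqNgt ltnS le_d.
  rewrite mpolyXE_id (bigD1 i) //= -(subnK le_i) exprD mulrAC; apply: (JM).
  exact: dP.
exists (fun t => pihomog mdeg d (h t)) => [t|]; first exact: pihomogP.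
rewrite -{1}[f](pihomog_dE hf).
have -> : \sum_t linear_form Q t * pihomog mdeg d (h t) =
    pihomog mdeg d.+1 (\sum_t linear_form Q t * h t).
  rewrite (raddf_sum (pihomog mdeg d.+1)); apply: eq_bigr => t _.
  by rewrite -add1n; apply/esym; exact: (pihomogM d (h t) (linear_form_homog Q t)).
apply/eqP; rewrite -subr_eq0 -comp_mpolyB -linearB /=.
by rewrite (pihomog_comp _ _ e_gt0 w_homog) hP pihomog0.
Qed.

(** Graded Nakayama: a form of degree above [m] is traded for forms of degree one less, with linear
    coefficients. The bound on [msize (g b)], that is, degree at most [D], feeds the count in
    [meets_cone_of_codim]. *)
Lemma cone_module_finite (r : nat) (Q : 'M[K]_(r, M)) : ~ meets_cone Q ->
  exists m, forall D (f : {mpoly K[M]}), f \is D.-homog ->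
    exists2 g : 'X_{1..M < m} -> {mpoly K[r]}, forall b, (msize (g b) <= D.+1)%N &
      f \mPo w = \sum_(b : 'X_{1..M < m})
        (g b \mPo [tuple linear_form Q t \mPo w | t < r]) * ('X_[b] \mPo w).
Proof.
move=> /linear_forms_irrelevant[m mP]; exists m.+1; elim=> [|D IHD] f hf.
  exists (fun b => (f@_b)%:MP) => [b|]; first by rewrite msizeC; case: (_ != _).
  rewrite {1}[f](@mpolywE _ _ m.+1) => [|].
    rewrite raddf_sum /=; apply: eq_bigr => b _.
    by rewrite comp_mpolyC mul_mpolyC comp_mpolyZ.
  rewrite msizeE; apply/bigmax_leqP_seq => b bf _.
  by rewrite (dhomog_mf hf bf).
have [lt_m|le_m] := ltnP D m.
  exists (fun b => (f@_b)%:MP) => [b|]; first by rewrite msizeC; case: (_ != _).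
  rewrite {1}[f](@mpolywE _ _ m.+1) => [|].
    rewrite raddf_sum /=; apply: eq_bigr => b _.
    by rewrite comp_mpolyC mul_mpolyC comp_mpolyZ.
  rewrite msizeE; apply/bigmax_leqP_seq => b bf _.
  by rewrite (dhomog_mf hf bf).
have [h hh ef] := mP D f le_m hf.
have [|g gP] := choice (fun t => _ : exists g : 'X_{1..M < m.+1} -> {mpoly K[r]},
    (forall b, (msize (g b) <= D.+1)%N) /\ h t \mPo w = \sum_b
        (g b \mPo [tuple linear_form Q t \mPo w | t < r]) * ('X_[b] \mPo w)).
  by move=> t; have [g g1 g2] := IHD _ (hh t); exists g.
exists (fun b => \sum_t 'X_t * g t b) => [b|].
  apply: leq_trans (msize_sum _ _ _) _; apply/bigmax_leqP => t _.
  have [->|g0] := eqVneq (g t b) 0; first by rewrite mulr0 msize0.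
  have X0 : 'X_t != 0 :> {mpoly K[r]} by rewrite -msize_poly_eq0 msizeX.
  by rewrite msizeM // msizeX mdeg1 /= ltnS; case: (gP t).
rewrite ef raddf_sum /=.
under eq_bigr => t _ do rewrite rmorphM /= (gP t).2 mulr_sumr.
rewrite exchange_big; apply: eq_bigr => b _; rewrite raddf_sum mulr_suml.
apply: eq_bigr => t _; rewrite mulrA; congr (_ * _).
by rewrite /= rmorphM /= comp_mpolyXU -tnth_nth tnth_mktuple.
Qed.

Lemma card_bmultinom_le r D : (#|{: 'X_{1..r < D}}| <= D ^ r)%N.
Proof.
rewrite -[X in (_ <= X ^ _)%N]card_ord -[X in (_ <= _ ^ X)%N]card_ord -card_ffun.
have lt (b : 'X_{1..r < D}) i : (b i < D)%N.
  by apply: leq_ltn_trans (bmdeg b); rewrite mdegE (bigD1 i) //= leq_addr.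
pose F (b : 'X_{1..r < D}) := [ffun i => Ordinal (lt b i)].
apply: (@leq_card _ _ F) => b c /ffunP eF; apply/val_inj/mnmP => i.
by have := congr1 val (eF i); rewrite !ffunE.
Qed.

(* Otherwise the coordinate ring of the cone would be a finite module over a
   polynomial ring in [r] variables, whereas it contains one in [r.+1] variables;
   this contradicts the growth of the spaces of forms of bounded degree. *)
Lemma meets_cone_of_codim (r : nat) (ix : 'I_r.+1 -> 'I_M) (Q : 'M[K]_(r, M)) :
  (forall h : {mpoly K[r.+1]}, h \mPo [tuple tnth w (ix j) | j < r.+1] = 0 -> h = 0) ->
  meets_cone Q.
Proof.
move=> indep; apply: contrapT => /cone_module_finite[m mP].
set C := #|{: 'X_{1..M < m}}|.
(* The [B^(r+1)] monomials with exponents below [B], of degree at most [D], face at most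
   [C * (D+1)^r <= C * (r+2)^r * B^r] coefficients; this [B] makes them linearly dependent. *)
pose B := (C * (r.+2) ^ r).+1; pose D := (r.+1 * B)%N.
pose mon (c : {ffun 'I_r.+1 -> 'I_B}) : 'X_{1..M} := (\sum_j U_(ix j) *+ c j)%MM.
have deg_mon c : (mdeg (mon c) <= D)%N.
  rewrite mdeg_sum /D -[X in (_ <= X * _)%N]card_ord -sum_nat_const.
  apply: leq_sum => j _; rewrite mdegMn mdeg1 mul1n; exact: ltnW.
have [|g gP] := choice (fun c => _ : exists g : 'X_{1..M < m} -> {mpoly K[r]},
    (forall b, (msize (g b) <= D.+1)%N) /\ 'X_[mon c] \mPo w = \sum_b
        (g b \mPo [tuple linear_form Q t \mPo w | t < r]) * ('X_[b] \mPo w)).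
  move=> c; have [|g g1 g2] := mP (mdeg (mon c)) 'X_[mon c]; first by rewrite dhomogX.
  by exists g; split=> // b; apply: leq_trans (g1 b) _; rewrite ltnS.
pose col : finType := ('X_{1..M < m} * 'X_{1..r < D.+1})%type.
pose A := \matrix_(i < #|{ffun 'I_r.+1 -> 'I_B}|, j < #|col|)
   (g (enum_val i) (enum_val j).1)@_((enum_val j).2).
have : kermx A != 0.
  rewrite kermx_eq0 -row_leq_rank -ltnNge; apply: leq_ltn_trans (rank_leq_col _) _.
  rewrite card_prod card_ffun !card_ord -/C.
  apply: leq_ltn_trans (_ : C * (r.+2 * B) ^ r < _)%N.
    rewrite leq_mul2l; apply/orP; right; apply: leq_trans (card_bmultinom_le _ _) _.
    have leD : (D.+1 <= r.+2 * B)%N by rewrite /D [in X in (_ <= X)%N]mulSn addnC -addn1 leq_add2l.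
    by case: (posnP r) => [->|r0]; rewrite ?expn0 ?leq_exp2r.
  by rewrite expnMn mulnA expnS ltn_pmul2r ?expn_gt0 // ltnSn.
move=> /rowV0Pn[l /sub_kermxP lA l0]; case/eqP: l0.
pose hm (c : {ffun 'I_r.+1 -> 'I_B}) : 'X_{1..r.+1} := [multinom c j : nat | j < r.+1].
have hm_inj : injective hm.
  by move=> c d /mnmP ecd; apply/ffunP => j; apply/val_inj; have := ecd j; rewrite !mnmE.
pose h : {mpoly K[r.+1]} := \sum_i l 0 i *: 'X_[hm (enum_val i)].
have h0 : h = 0.
  apply: indep; rewrite raddf_sum /=.
  have -> : \sum_i ((l 0 i *: 'X_[hm (enum_val i)]) \mPo
        [tuple tnth w (ix j) | j < r.+1]) = \sum_i l 0 i *: ('X_[mon (enum_val i)] \mPo w).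
    apply: eq_bigr => i _; rewrite comp_mpolyZ; congr (_ *: _).
    rewrite /mon -mprodXE rmorph_prod [LHS]comp_mpolyX; apply: eq_bigr => j _ /=.
    by rewrite -mpolyXn rmorphXn /= comp_mpolyXU -tnth_nth tnth_mktuple mnmE.
  under eq_bigr => i _ do rewrite (gP (enum_val i)).2 scaler_sumr.
  rewrite exchange_big; apply: big1 => b _ /=.
  under eq_bigr => i _ do rewrite scalerAl -comp_mpolyZ.
  rewrite -mulr_suml -raddf_sum /=.
  suff -> : \sum_i l 0 i *: g (enum_val i) b = 0 by rewrite comp_mpoly0 mul0r.
  apply/mpolyP => u; rewrite mcoeff0 raddf_sum /=.
  have [ltu|geu] := ltnP (mdeg u) D.+1.
    have := congr1 (fun v : 'rV_ _ => v 0 (enum_rank (b, BMultinom ltu))) lA.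
    rewrite !mxE => e0; rewrite -[RHS]e0; apply: eq_bigr => i _.
    by rewrite mcoeffZ !mxE enum_rankK.
  apply: big1 => i _; rewrite mcoeffZ memN_msupp_eq0 ?mulr0 //.
  exact: msize_mdeg_ge (leq_trans ((gP _).1 _) geu).
apply/rowP => i; rewrite mxE; move/(congr1 (mcoeff (hm (enum_val i)))): h0.
rewrite raddf_sum mcoeff0 (bigD1 i) //= big1 => [|j ji].
  by rewrite addr0 mcoeffZ mcoeffX eqxx mulr1.
by rewrite mcoeffZ mcoeffX (inj_eq hm_inj) (inj_eq enum_val_inj) (negPf ji) mulr0.
Qed.

End Cone.

(** * The Chow form of a cone *)

Definition mxeval (R : nzRingType) (m n : nat) (f : {mpoly R[m * n]}) (Q : 'M[R]_(m, n)) : R :=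
  f.@[mxvec Q 0].

Section Paths.
Variable (R : comNzRingType).

Lemma horner_mmap n (v : 'I_n -> {poly R}) (f : {mpoly R[n]}) s :
  (mmap polyC v f).[s] = f.@[fun i => (v i).[s]].
Proof.
elim/mpolyind: f => [|c m f _ _ IHf]; first by rewrite mmap0 meval0 horner0.
rewrite mmapD mevalD hornerD IHf; congr (_ + _).
rewrite mmapZ mevalZ hornerM hornerC mmapX mevalX /mmap1 horner_prod; congr (_ * _).
by apply: eq_bigr => i _; rewrite horner_exp.
Qed.

Definition mxpath (m n : nat) (f : {mpoly R[m * n]}) (Q : 'M[{poly R}]_(m, n)) : {poly R} :=
  mmap polyC (mxvec Q 0) f.

Lemma horner_mxpath (m n : nat) (f : {mpoly R[m * n]}) (Q : 'M[{poly R}]_(m, n)) s :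
  (mxpath f Q).[s] = mxeval f (map_mx (horner_eval s) Q).
Proof.
rewrite horner_mmap; apply: meval_eq => i.
by case/mxvec_indexP: i => i j; rewrite !mxvecE mxE.
Qed.
End Paths.

Lemma msize_comp_linear (R : comNzRingType) n k (l : n.-tuple {mpoly R[k]}) f :
  (forall i, tnth l i \is 1.-homog) -> (msize (f \mPo l) <= msize f)%N.
Proof.
move=> hl; rewrite comp_mpolyEX.
apply: leq_trans (msize_sum _ _ _) _; apply/bigmax_leqP_seq => m mf _.
apply: leq_trans (msizeZ_le _ _) _; rewrite msizeE; apply/bigmax_leqP_seq => u uf _.
have := comp_homogX m hl; rewrite mul1n => h.
by rewrite (dhomog_mf h uf) msize_mdeg_lt.
Qed.

(** Being free of the [i]-th variable is expressed on values, so that it applies to a number of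
    variables such as [r.+1 * M], not written as a successor. *)
Lemma mpoly_prime_ideal_principal_var (K : fieldType) N (i : 'I_N)
    (I : {mpoly K[N]} -> Prop) :
  (forall f g, I f -> I g -> I (f - g)) -> (forall f g, I f -> I (g * f)) ->
  (forall f g, I (f * g) -> I f \/ I g) ->
  (forall c, I c -> (forall v v' : 'I_N -> K, (forall j, j != i -> v j = v' j) ->
     c.@[v] = c.@[v']) -> c = 0) -> (exists2 f, I f & f != 0) ->
  exists F, [/\ I F, F != 0 & forall g, I g -> divides F g].
Proof.
case: N i I => [[]//|n] i I IB IM Ip IC If.
apply: (mpoly_prime_ideal_principal (i := i) IB IM Ip) => // c /IC c0.
have := congr1 (mpoly_uni i) (c0 _); rewrite mpoly_uni_lift rmorph0 => e.
apply: (@polyC_inj _); rewrite e // => v v' ev; rewrite !meval_lift.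
by apply: meval_eq => j; apply: ev; rewrite eq_sym neq_lift.
Qed.

Section ChowForm.
Variables (K : closedFieldType) (p M e r : nat) (w : M.-tuple {mpoly K[p]}).
Variable ix : 'I_r.+1 -> 'I_M.
Hypothesis ch0 : [pchar K] =i pred0.
Hypothesis uncK : uncountable_type K.
Hypothesis e_gt0 : (0 < e)%N.
Hypothesis w_homog : forall i, tnth w i \is e.-homog.
Hypothesis w_closed : forall x : 'I_M -> K,
  (forall g : {mpoly K[M]}, g \mPo w = 0 -> g.@[x] = 0) ->
  exists y, forall i, x i = (tnth w i).@[y].
Hypothesis w_indep : forall h : {mpoly K[r.+1]},
  h \mPo [tuple tnth w (ix j) | j < r.+1] = 0 -> h = 0.

Local Notation meets := (meets_cone w).
Local Notation pt := (cone_point w).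

(* The cone being the image of [w], this is the ideal of the hypersurface of the
   Chow form. *)
Definition chow_ideal (f : {mpoly K[r.+1 * M]}) : Prop :=
  forall Q : 'M[K]_(r.+1, M), meets Q -> mxeval f Q = 0.

(* Let [x^b = sum_t P_t h_(b,t)] on the cone for the monomials [x^b] of some degree
   [d.+1]. If the forms [Q_t] vanish at a point of the cone, then so do all the
   [x^b - sum_t P_t h_(b,t) + sum_t Q_t h_(b,t)], whose matrix of coefficients is thus
   singular; for [Q = P] this matrix is the identity. *)
Lemma chow_ideal_separates (P : 'M[K]_(r.+1, M)) : ~ meets P ->
  exists2 f, chow_ideal f & mxeval f P = 1.
Proof.
move=> nP; have [d dP] := linear_forms_irrelevant uncK e_gt0 w_homog w_closed nP.
pose T : finType := 'X_{1..M < d.+2}.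
have /choice[h hP] : forall b : T, exists h : 'I_r.+1 -> {mpoly K[M]},
    mdeg b = d.+1 -> (forall t, h t \is d.-homog) /\
      'X_[b] \mPo w = (\sum_t linear_form P t * h t) \mPo w.
  move=> b; have [db|nb] := pselect (mdeg b = d.+1); last by exists (fun=> 0).
  by have [|h h1 h2] := dP d 'X_[b] (leqnn _); rewrite ?dhomogX /= ?db //; exists h.
pose g (b : T) (Q : 'M[K]_(r.+1, M)) : {mpoly K[M]} :=
  'X_[b] - \sum_t linear_form P t * h b t + \sum_t linear_form Q t * h b t.
pose ev (i : 'I_#|T|) : 'X_{1..M < d.+2} := enum_val i.
(* In a row of degree [d.+1] stand the coefficients of [g b Q], as polynomials in the entries of
   [Q]; the monomials of lower degree, also in [T], get rows of the identity. *)
pose C := \matrix_(i < #|T|, j < #|T|)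
  if mdeg (ev i) == d.+1 then
    (('X_[ev i] - \sum_t linear_form P t * h (ev i) t)@_(ev j))%:MP +
    \sum_t \sum_a ('X_a * h (ev i) t)@_(ev j) *: 'X_(mxvec_index t a)
  else (i == j)%:R : {mpoly K[r.+1 * M]}.
have CE Q : map_mx (meval (mxvec Q 0)) C = \matrix_(i, j)
   if mdeg (ev i) == d.+1 then (g (ev i) Q)@_(ev j) else (i == j)%:R.
  apply/matrixP => i j; rewrite !mxE; case: eqP => _; last by rewrite rmorph_nat.
  rewrite mevalD mevalC /g [RHS]mcoeffD; congr (_ + _).
  rewrite !raddf_sum /=; apply: eq_bigr => t _.
  rewrite mulr_suml !raddf_sum /=; apply: eq_bigr => a _.
  by rewrite mevalZ mevalXU mxvecE -scalerAl mcoeffZ mulrC.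
exists (\det C) => [Q [y y0 Qy]|]; last first.
  rewrite /mxeval -det_map_mx CE -[RHS](det1 K #|T|); congr (\det _).
  apply/matrixP => i j; rewrite !mxE /g subrK mcoeffX; case: eqP => // _.
  by rewrite (inj_eq val_inj) (inj_eq enum_val_inj).
rewrite /mxeval -det_map_mx CE; set A := \matrix_(i, j) _.
(* The kernel vector lists the values at the common point of the monomials of degree [d.+1]; a power
   of a nonzero coordinate is among them. *)
pose v : 'cV[K]_#|T| := \col_i
  if mdeg (ev i) == d.+1 then ('X_[ev i] \mPo w).@[y] else 0.
have v0 : v != 0.
  have /cV0Pn[a wa] := y0.
  have db : (mdeg (U_(a) *+ d.+1)%MM < d.+2)%N by rewrite mdegMn mdeg1 mul1n.
  apply/eqP => /colP/(_ (enum_rank (BMultinom db))).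
  rewrite !mxE /ev enum_rankK /= mdegMn mdeg1 mul1n eqxx -mpolyXn rmorphXn /= comp_mpolyXU.
  rewrite -tnth_nth rmorphXn /= => /eqP; rewrite expf_eq0 /= => /eqP wa0.
  by move: wa; rewrite mxE wa0 eqxx.
have Av : A *m v = 0.
  apply/colP => i; rewrite [RHS]mxE mxE.
  case: (altP (mdeg (ev i) =P d.+1)) => [di|/negPf ni]; last first.
    under eq_bigr => j _ do rewrite [A i j]mxE ni.
    rewrite (bigD1 i) //= big1 => [|j ji]; last by rewrite eq_sym (negPf ji) mul0r.
    by rewrite addr0 mxE ni mulr0.
  have [hh hw] := hP _ di.
  have gh : g (ev i) Q \is d.+1.-homog.
    have lh (S : 'M[K]_(r.+1, M)) : \sum_t linear_form S t * h (ev i) t \is d.+1.-homog.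
      apply: rpred_sum => t _; exact: (dhomogM (linear_form_homog S t) (hh t)).
    apply: rpredD (lh Q); apply: rpredB (lh P).
    by rewrite dhomogX /= di.
  transitivity ((g (ev i) Q \mPo w).@[y]).
    rewrite [in RHS](@mpolywE _ _ d.+2 (g _ _)); last first.
      by rewrite msizeE; apply/bigmax_leqP_seq => u uf _; rewrite (dhomog_mf gh uf).
    rewrite (raddf_sum (comp_mpoly w)) (raddf_sum (meval y)) /= [RHS](reindex (@enum_val _ T)) /=; last first.
      by apply: onW_bij; exact: enum_val_bij.
    apply: eq_bigr => j _; rewrite comp_mpolyZ mevalZ !mxE di eqxx.
    case: eqP => // /eqP nj; rewrite mulr0 (dhomog_nemf_coeff gh) ?mul0r //.
  rewrite comp_mpolyD comp_mpolyB hw subrr add0r (raddf_sum (comp_mpoly w)) (raddf_sum (meval y)) /= big1 // => t _.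
  rewrite rmorphM rmorphM /= comp_mpoly_meval meval_linear_form.
  by move/colP: Qy => /(_ t); rewrite /cone_point => ->; rewrite mxE mul0r.
apply/eqP; apply: contraNT v0 => dA.
have uA : A \in unitmx by rewrite unitmxE unitfE.
by rewrite -[v](mulKmx uA) Av mulmx0.
Qed.

Lemma chow_idealB f g : chow_ideal f -> chow_ideal g -> chow_ideal (f - g).
Proof. by move=> If Ig Q mQ; rewrite /mxeval mevalB [_.@[_]]If // [_.@[_]]Ig // subr0. Qed.

Lemma chow_idealM f g : chow_ideal f -> chow_ideal (g * f).
Proof. by move=> If Q mQ; rewrite /mxeval mevalM [f.@[_]]If // mulr0. Qed.

(* Two points of the incidence locus are joined by a polynomial path inside it. *)
Lemma chow_ideal_prime f g : chow_ideal (f * g) -> chow_ideal f \/ chow_ideal g.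
Proof.
move=> Ifg; apply: contrapT => /not_orP[].
move=> /existsNP[Q1 /not_implyP[[y1 y10 Qy1] f1]].
move=> /existsNP[Q2 /not_implyP[[y2 y20 Qy2] g2]].
have coord (u : 'cV[K]_M) : u != 0 -> exists l : 'rV[K]_M, l *m u = 1%:M.
  move=> /cV0Pn[i ui].
  exists ((u i 0)^-1 *: delta_mx 0 i); rewrite -scalemxAl -rowE; apply/matrixP => a b.
  by rewrite !ord1 !mxE mulVf ?mulr1n.
have [l1 lu1] := coord _ y10; have [l2 lu2] := coord _ y20.
pose path m n (A B : 'M[K]_(m, n)) : 'M[{poly K}]_(m, n) :=
  map_mx polyC A + 'X *: map_mx polyC (B - A).
have pathE m n (A B : 'M[K]_(m, n)) s :
    map_mx (horner_eval s) (path m n A B) = A + s *: (B - A).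
  by apply/matrixP => i j; rewrite !mxE /horner_eval hornerD hornerM hornerX !hornerC.
pose yp i : {poly K} := (y1 i)%:P + 'X * (y2 i - y1 i)%:P.
pose Ap : 'cV[{poly K}]_M := \col_i mmap polyC yp (tnth w i).
have ApE s : map_mx (horner_eval s) Ap = pt (fun i => y1 i + s * (y2 i - y1 i)).
  apply/colP => i; rewrite !mxE /horner_eval horner_mmap; apply: meval_eq => j.
  by rewrite hornerD hornerM hornerX !hornerC.
pose ep := path _ _ l1 l2; pose Bp := path _ _ Q1 Q2.
(* This combination of the paths of [l], of points and of [Q] kills [Ap] identically; at the ends,
   [l A = 1] and [Q A = 0] reduce it to [Q1] and [Q2]. *)
pose Qp := (ep *m Ap) 0 0 *: Bp - Bp *m Ap *m ep.
pose E s := l1 + s *: (l2 - l1); pose B s := Q1 + s *: (Q2 - Q1).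
pose A s := pt (fun i => y1 i + s * (y2 i - y1 i)).
have QpE s : map_mx (horner_eval s) Qp =
    (E s *m A s) 0 0 *: B s - B s *m A s *m E s.
  rewrite map_mxB map_mxZ !map_mxM /= !pathE ApE; congr (_ *: _ - _).
  by have := congr1 (fun Z : 'M_1 => Z 0 0) (map_mxM (horner_eval s) ep Ap);
    rewrite [LHS]mxE => ->; rewrite pathE ApE.
have A0 : A 0 = pt y1 by apply/colP => i; rewrite !mxE; apply: meval_eq => j; rewrite mul0r addr0.
have A1 : A 1 = pt y2.
  by apply/colP => i; rewrite !mxE; apply: meval_eq => j; rewrite mul1r addrC subrK.
have Q0E : map_mx (horner_eval 0) Qp = Q1.
  by rewrite QpE A0 /E /B !scale0r !addr0 Qy1 mul0mx subr0 lu1 mxE scale1r.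
have Q1E : map_mx (horner_eval 1) Qp = Q2.
  rewrite QpE A1 /E /B !scale1r addrC addrC ![_ + (_ - _)]addrC !subrK Qy2 mul0mx subr0 lu2.
  by rewrite mxE scale1r.
have meetsQ s : meets (map_mx (horner_eval s) Qp).
  (* Where the path of points passes through the vertex, [Qp] is zero and every point of the cone
     will do. *)
  have [z|nz] := eqVneq (A s) 0.
    by exists y1 => //; rewrite QpE z !mulmx0 mxE scale0r mul0mx subr0 mul0mx.
  exists (fun i => y1 i + s * (y2 i - y1 i)) => //; rewrite -/(A s) QpE mulmxBl.
  set a := (E s *m A s) 0 0.
  rewrite -scalemxAl -[B s *m A s *m E s *m A s]mulmxA (mx11_scalar (E s *m A s)) -/a.
  by rewrite mul_mx_scalar subrr.
have : mxpath f Qp * mxpath g Qp == 0.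
  apply: contraT => /(poly_neq0_eval ch0)[s]; rewrite hornerM !horner_mxpath.
  by rewrite /mxeval -mevalM -/(mxeval _ _) Ifg ?eqxx.
rewrite mulf_eq0 => /orP[]/eqP z.
  by case: f1; rewrite -Q0E -horner_mxpath z horner0.
by case: g2; rewrite -Q1E -horner_mxpath z horner0.
Qed.

(* If each variable [(0, i)] were absent from some nonzero element of the ideal, a
   point [Q] where none of these elements vanishes could be moved into the incidence
   locus by changing one entry of its first row. *)
Lemma chow_ideal_elimination : exists i0 : 'I_M, forall c, chow_ideal c ->
  (forall v v' : 'I_(r.+1 * M) -> K,
     (forall j, j != mxvec_index ord0 i0 -> v j = v' j) -> c.@[v] = c.@[v']) -> c = 0.
Proof.
apply: contrapT => /forallNP none.
have /choice[c cP] : forall i0 : 'I_M, exists c, [/\ chow_ideal c, c != 0 &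
   forall v v' : 'I_(r.+1 * M) -> K,
     (forall j, j != mxvec_index ord0 i0 -> v j = v' j) -> c.@[v] = c.@[v']].
  move=> i0; have /existsNP[c /not_implyP[Ic /not_implyP[fc /eqP c0]]] := none i0.
  by exists c.
have /(mpoly_neq0_eval ch0)[v] : \prod_i c i != 0.
  by apply/prodf_neq0 => i _; case: (cP i).
rewrite rmorph_prod => /prodf_neq0 cv.
pose Q : 'M[K]_(r.+1, M) := vec_mx (\row_j v j).
have vQ : v =1 mxvec Q 0 by move=> j; rewrite /Q vec_mxK mxE.
have [y y0 Qy] := meets_cone_of_codim uncK e_gt0 w_homog w_closed (row' ord0 Q) w_indep.
have /cV0Pn[i yi] := y0.
have [Ic _ fc] := cP i; case/negP: (cv i isT).
(* Correcting the entry [(0, i)] by [c0] makes the first row vanish at [y] as well; [c i] does not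
   see that entry. *)
pose c0 := (Q *m pt y) ord0 0 / pt y i 0; pose Q' := Q - c0 *: delta_mx ord0 i.
have dE t : (delta_mx ord0 i *m pt y : 'cV_r.+1) t 0 = (t == ord0)%:R * pt y i 0.
  rewrite mxE (bigD1 i) //= big1 => [|j ji]; last by rewrite mxE (negPf ji) andbF mul0r.
  by rewrite mxE eqxx andbT addr0.
have Q'E t : (Q' *m pt y) t 0 = (Q *m pt y) t 0 - c0 * ((t == ord0)%:R * pt y i 0).
  rewrite mulmxBl -scalemxAl -dE; move: (Q *m pt y) (delta_mx ord0 i *m pt y) => Z1 Z2.
  by rewrite !mxE.
rewrite /= (fc _ (mxvec Q' 0)) => [|j].
  apply/eqP; apply: Ic; exists y => //.
  apply/colP => t; rewrite Q'E [RHS]mxE; case: (unliftP ord0 t) => [t' ->|->].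
    move/colP: Qy => /(_ t'); rewrite [RHS]mxE => Qyt.
    rewrite eq_sym (negPf (neq_lift _ _)) mul0r mulr0 subr0.
    rewrite -[RHS]Qyt [LHS]mxE [RHS]mxE; apply: eq_bigr => j _.
    by rewrite [row' _ _ _ _]mxE.
  by rewrite eqxx mul1r divfK // subrr.
rewrite vQ; case/mxvec_indexP: j => a b ab; rewrite !mxvecE !mxE.
have [ea|na] := eqVneq a ord0; last by rewrite mulr0 subr0.
have [eb|nb] := eqVneq b i; last by rewrite mulr0 subr0.
by rewrite ea eb eqxx in ab.
Qed.

Lemma chow_form_exists (P : 'M[K]_(r.+1, M)) : ~ meets P ->
  exists F, [/\ chow_ideal F, F != 0, mxeval F P != 0 &
    forall g, chow_ideal g -> divides F g].
Proof.
move=> /chow_ideal_separates[f If fP]; have [i0 elim0] := chow_ideal_elimination.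
have [||F [IF F0 gen]] := @mpoly_prime_ideal_principal_var _ _ (mxvec_index ord0 i0) _
  chow_idealB chow_idealM chow_ideal_prime.
- exact: elim0.
- exists f => //; apply: contraTneq (oner_neq0 K) => f0; rewrite negbK.
  by rewrite -fP f0 /mxeval meval0.
exists F; split=> //; have [h fE] := gen f If.
apply: contraTneq (oner_neq0 K) => FP; rewrite negbK -fP fE /mxeval mevalM.
by rewrite [F.@[_]]FP mulr0.
Qed.

Definition mx_action_forms (A : 'M[K]_r.+1) (B : 'M[K]_M) : (r.+1 * M).-tuple {mpoly K[r.+1 * M]} :=
  [tuple mxvec (map_mx (@mpolyC _ K) A *m vec_mx (\row_j 'X_j) *m map_mx (@mpolyC _ K) B) 0 j
     | j < r.+1 * M].

Lemma mxeval_action f A B Q :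
  mxeval (f \mPo mx_action_forms A B) Q = mxeval f (A *m Q *m B).
Proof.
rewrite /mxeval comp_mpoly_meval; apply: meval_eq => j; rewrite tnth_mktuple.
case/mxvec_indexP: j => a b; rewrite !mxvecE !mxE raddf_sum; apply: eq_bigr => c _ /=.
rewrite mevalM !mxE mevalC raddf_sum; congr (_ * _); apply: eq_bigr => d _ /=.
by rewrite mevalM !mxE mevalC mevalXU mxvecE.
Qed.

Lemma mx_action_forms_homog A B i : tnth (mx_action_forms A B) i \is 1.-homog.
Proof.
rewrite tnth_mktuple; case/mxvec_indexP: i => a b; rewrite mxvecE mxE.
apply: rpred_sum => c _; rewrite !mxE mulrC mul_mpolyC; apply: rpredZ.
apply: rpred_sum => d _; rewrite !mxE mul_mpolyC; apply: rpredZ.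
by rewrite dhomogX /= mdeg1.
Qed.

(** [F (A Q B)] lies in the ideal, so [F] divides it; a linear substitution does not raise the
    degree, so the quotient is a constant. *)
Lemma chow_form_semi_invariant F (A : 'M[K]_r.+1) (B : 'M[K]_M) :
  chow_ideal F -> F != 0 -> (forall g, chow_ideal g -> divides F g) ->
  (forall Q, meets Q -> meets (A *m Q *m B)) ->
  exists c, forall Q, mxeval F (A *m Q *m B) = c * mxeval F Q.
Proof.
move=> IF F0 gen stab.
have [|h hE] := gen (F \mPo mx_action_forms A B).
  by move=> Q mQ; rewrite mxeval_action; apply: IF; apply: stab.
have sh : (msize h <= 1)%N.
  have [->|h0] := eqVneq h 0; first by rewrite msize0.
  have := msize_comp_linear F (mx_action_forms_homog A B).
  have sF : (0 < msize F)%N by rewrite lt0n msize_poly_eq0.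
  by rewrite hE msizeM // -(prednK sF) addnS /= -[X in (_ <= X)%N]add1n leq_add2r.
exists h@_0 => Q; rewrite -mxeval_action hE /mxeval mevalM.
by rewrite [in LHS](msize1_polyC sh) mevalC.
Qed.

End ChowForm.

(** * Polynomial characters of the general linear group *)

Section PolynomialCharacters.
Variables (C : numClosedFieldType) (n : nat) (chi : 'M[C]_n.+1 -> C).

Lemma poly_eq_off0 (p q : {poly C}) :
  (forall s, s != 0 -> p.[s] = q.[s]) -> p = q.
Proof.
move=> epq; apply/eqP; rewrite -subr_eq0; apply: contraT => d0.
have Xd0 : 'X * (p - q) != 0 by rewrite mulf_neq0 ?polyX_eq0.
have [s] := poly_neq0_eval (@pchar_num C) Xd0.
rewrite hornerM hornerX hornerD hornerN.
have [->|s0] := eqVneq s 0; first by rewrite mul0r eqxx.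
by rewrite epq // subrr mulr0 eqxx.
Qed.

(** Write [p = q X^e] with [q(0)] nonzero. Then [q (t s) = q(t) q(s)] for all nonzero [s], hence as
    polynomials in [s], and [s = 0] gives [q(t) = 1]. *)
Lemma multiplicative_poly (p : {poly C}) : p.[1] = 1 ->
  (forall s t, s != 0 -> t != 0 -> p.[s * t] = p.[s] * p.[t]) ->
  exists e, forall t, t != 0 -> p.[t] = t ^+ e.
Proof.
move=> p1 pM; have p0 : p != 0 by apply: contra_eq_neq p1 => ->; rewrite horner0 eq_sym oner_eq0.
have [e [q]] := multiplicity_XsubC p 0; rewrite p0 /= rootE subr0 => q0 pE.
have pqE t : p.[t] = q.[t] * t ^+ e by rewrite pE hornerM hornerXn.
exists e => t t0; rewrite pqE.
suff -> : q.[t] = 1 by rewrite mul1r.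
have : q \Po (t *: 'X) = q.[t] *: q.
  apply: poly_eq_off0 => s s0; rewrite horner_comp hornerZ hornerX hornerZ.
  have := pM t s t0 s0; rewrite !pqE exprMn mulrACA => /mulIf -> //.
  by rewrite mulf_neq0 // expf_neq0.
move/(congr1 (horner^~ 0)); rewrite horner_comp !hornerZ hornerX mulr0 => e0.
by apply: (mulIf q0); rewrite mul1r.
Qed.

Hypothesis chi1 : chi 1%:M = 1.
Hypothesis chiM : forall A B, A \in unitmx -> B \in unitmx -> chi (A *m B) = chi A * chi B.
Hypothesis chi_path : forall A : 'M[{poly C}]_n.+1, exists p : {poly C},
  forall s, p.[s] = chi (map_mx (horner_eval s) A).

Lemma chi_conj P A : P \in unitmx -> A \in unitmx -> chi (P *m A *m invmx P) = chi A.
Proof.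
move=> uP uA; rewrite !chiM ?unitmx_mul ?unitmx_inv ?uP // mulrAC -chiM ?unitmx_inv //.
by rewrite mulmxV // chi1 mul1r.
Qed.

Let D (i : 'I_n.+1) (t : C) : 'rV[C]_n.+1 := \row_j if j == i then t else 1.

Lemma chi_coord : exists e, forall i t, t != 0 -> chi (diag_mx (D i t)) = t ^+ e.
Proof.
have uD i t : t != 0 -> diag_mx (D i t) \in unitmx.
  move=> t0; rewrite unitmxE det_diag unitfE; apply/prodf_neq0 => j _.
  by rewrite mxE; case: ifP => // _; rewrite oner_neq0.
have [p pP] : exists p : {poly C}, forall t, p.[t] = chi (diag_mx (D ord0 t)).
  have [p pP] := chi_path (diag_mx (\row_j if j == ord0 then 'X else 1)).
  exists p => t; rewrite pP; congr chi; apply/matrixP => a b; rewrite !mxE.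
  by case: (a == ord0); rewrite /horner_eval hornerMn ?hornerX ?hornerC.
have [||e eP] := @multiplicative_poly p.
- by rewrite pP -[RHS]chi1; congr chi;
    apply/matrixP => a b; rewrite !mxE if_same.
- move=> s t s0 t0; rewrite !pP -chiM ?uD // mulmx_diag; congr (chi (diag_mx _)).
  by apply/rowP => j; rewrite !mxE; case: ifP; rewrite ?mulr1.
exists e => i t t0; rewrite -eP // pP.
pose S := perm_mx (tperm i ord0) : 'M[C]_n.+1.
have uS : S \in unitmx by exact: unitmx_perm.
rewrite -(chi_conj uS (uD ord0 t t0)); congr chi.
have SS : S *m S = 1%:M by rewrite /S -perm_mxM tperm2 perm_mx1.
have -> : invmx S = S by rewrite -[LHS]mulmx1 -SS mulmxA mulVmx ?mul1mx.
rewrite /S -row_permE -[in X in _ *m X](tpermV i ord0) -col_permE.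
apply/matrixP => a b; rewrite !mxE (inj_eq perm_inj).
by rewrite -[X in _ = (if _ == X then _ else _) *+ _](tpermL i ord0) (inj_eq perm_inj).
Qed.

Lemma chi_diag : exists e, forall d : 'rV[C]_n.+1, (forall i, d 0 i != 0) ->
  chi (diag_mx d) = \det (diag_mx d) ^+ e.
Proof.
have [e eP] := chi_coord; exists e => d d0.
pose T m : 'rV[C]_n.+1 := \row_j if (j < m)%N then d 0 j else 1.
have T0 m j : T m 0 j != 0 by rewrite mxE; case: ifP; rewrite ?oner_neq0.
suff H m : (m <= n.+1)%N -> chi (diag_mx (T m)) = (\prod_(j < n.+1 | (j < m)%N) d 0 j) ^+ e.
  have := H n.+1 (leqnn _); rewrite det_diag.
  have -> : T n.+1 = d by apply/rowP => j; rewrite mxE ltn_ord.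
  by move=> ->; congr (_ ^+ _); apply: eq_bigl => j; rewrite ltn_ord.
elim: m => [_|m IHm lt_m].
  rewrite big_pred0 // expr1n -[RHS]chi1; congr chi.
  by apply/matrixP => a b; rewrite !mxE.
have -> : diag_mx (T m.+1) = diag_mx (T m) *m diag_mx (D (Ordinal lt_m) (d 0 (Ordinal lt_m))).
  rewrite mulmx_diag; congr diag_mx; apply/rowP => j; rewrite !mxE ltnS leq_eqVlt -val_eqE /=.
  have [ej|nj] := eqVneq (val j) m; last by rewrite mulr1.
  by rewrite ej ltnn /= mul1r; congr (d 0 _); apply/val_inj.
have ud (v : 'rV[C]_n.+1) : (forall j, v 0 j != 0) -> diag_mx v \in unitmx.
  by move=> v0; rewrite unitmxE det_diag unitfE; apply/prodf_neq0.
have uD : diag_mx (D (Ordinal lt_m) (d 0 (Ordinal lt_m))) \in unitmx.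
  by apply: ud => j; rewrite mxE; case: ifP; rewrite ?oner_neq0.
rewrite (chiM (ud _ (T0 m)) uD) (IHm (ltnW lt_m)) (eP _ _ (d0 _)) -exprMn.
congr (_ ^+ e); rewrite [RHS](bigD1 (Ordinal lt_m)) //= mulrC; congr (_ * _).
apply: eq_bigl => j.
by rewrite ltnS [RHS]andbC -val_eqE /= ltn_neqAle.
Qed.

(* Conjugation by [diag_mx (s ^+ i)] deforms a triangular matrix to its diagonal. *)
Lemma chi_trig (T : 'M[C]_n.+1) : is_trig_mx T -> T \in unitmx ->
  chi T = chi (diag_mx (\row_i T i i)).
Proof.
move=> /is_trig_mxP trT uT.
pose Tp : 'M[{poly C}]_n.+1 := \matrix_(i, j) ((T i j)%:P * 'X ^+ (i - j)).
have TpE s : map_mx (horner_eval s) Tp = \matrix_(i, j) (T i j * s ^+ (i - j)).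
  by apply/matrixP => i j; rewrite !mxE /horner_eval hornerM hornerC hornerXn.
have [p pP] := chi_path Tp.
have pE : p = (chi T)%:P.
  apply: poly_eq_off0 => s s0; rewrite pP hornerC TpE.
  pose S := diag_mx (\row_(i < n.+1) s ^+ i).
  have uS : S \in unitmx.
    by rewrite unitmxE det_diag unitfE; apply/prodf_neq0 => i _; rewrite mxE expf_neq0.
  rewrite -(chi_conj uS uT); congr chi; apply: (can_inj (mulmxK uS)).
  rewrite mulmxKV // mul_mx_diag mul_diag_mx; apply/matrixP => i j; rewrite !mxE.
  have [le_ij|lt_ij] := leqP j i; last by rewrite trT // mulr0 !mul0r.
  by rewrite -mulrA -exprD subnK // mulrC.
have := pP 0; rewrite pE hornerC TpE => ->; congr chi.
apply/matrixP => i j; rewrite !mxE; have [->|ne] := eqVneq i j.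
  by rewrite subnn expr0 mulr1n mulr1.
rewrite mulr0n; have [lt|gt|e] := ltngtP i j; last by rewrite (val_inj e) eqxx in ne.
  by rewrite trT // mul0r.
by rewrite expr0n subn_eq0 leqNgt gt /= mulr0.
Qed.

(** By Schur every matrix is conjugate to a triangular one, which deforms to its diagonal. On
    diagonal matrices [chi_path], the polynomiality of [chi] along curves, gives a power of each
    entry, with a single exponent since permutations exchange the entries. *)
Lemma polynomial_character : exists e, forall A, A \in unitmx -> chi A = \det A ^+ e.
Proof.
have [e eP] := chi_diag; exists e => A uA.
have [P uniP trig] := @Schur C n.+1 A isT.
have uP := unitarymx_unit uniP.
have {}trig : is_trig_mx (P *m A *m invmx P) by move: trig; rewrite /similar_to conjumx.
have uT : P *m A *m invmx P \in unitmx by rewrite !unitmx_mul unitmx_inv uP uA.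
have dT := det_trig trig.
rewrite -(chi_conj uP uA) chi_trig // eP => [|i]; last first.
  move: uT; rewrite unitmxE dT unitfE => /prodf_neq0/(_ i isT).
  by rewrite mxE.
have -> : \det A = \det (P *m A *m invmx P).
  by rewrite !det_mulmx mulrAC -det_mulmx mulmxV // det1 mul1r.
by rewrite dT det_diag; congr (_ ^+ _); apply: eq_bigr => i _; rewrite mxE.
Qed.
End PolynomialCharacters.

(** * The apolar pairing *)

Section Apolar.
Variables (K : numFieldType) (N : nat).
Implicit Types (a b : {mpoly K[N]}) (u : 'I_N -> K).

(** [a], read as a differential operator with constant coefficients, applied to [b] at the origin:
    the sum of the [m! a_m b_m]. *)
Definition apolar a b : K := \sum_(m <- msupp a) a@_m * (b^`M[m])@_0%MM.

Lemma apolarD a b c : apolar a (b + c) = apolar a b + apolar a c.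
Proof.
by rewrite /apolar -big_split; apply: eq_bigr => m _; rewrite mderivmD mcoeffD mulrDr.
Qed.

Lemma apolarZ a k b : apolar a (k *: b) = k * apolar a b.
Proof.
by rewrite /apolar big_distrr; apply: eq_bigr => m _; rewrite mderivmZ mcoeffZ mulrCA.
Qed.

Lemma apolar_sum a (T : Type) (s : seq T) (b : T -> {mpoly K[N]}) :
  apolar a (\sum_(t <- s) b t) = \sum_(t <- s) apolar a (b t).
Proof.
elim: s => [|t s IHs]; last by rewrite !big_cons apolarD IHs.
by rewrite !big_nil -[0](scale0r 0) apolarZ mul0r.
Qed.

Definition lform u : {mpoly K[N]} := \sum_i u i *: 'X_i.

Lemma meval_lform u v : (lform u).@[v] = \sum_i u i * v i.
Proof. by rewrite raddf_sum; apply: eq_bigr => i _ /=; rewrite mevalZ mevalXU. Qed.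

Lemma mderiv_lformX u i D : (lform u ^+ D)^`M(i) = (D%:R * u i) *: lform u ^+ D.-1.
Proof.
have dl : (lform u)^`M(i) = (u i)%:MP.
  have UU : (U_(i) - U_(i))%MM = 0%MM :> 'X_{1..N}.
    by apply/mnmP => k; rewrite mnmBE subnn mnm0E.
  rewrite raddf_sum (bigD1 i) //= big1 => [|j ji].
    by rewrite mderivZ mderivX mnm1E eqxx UU mpolyX0 scale1r addr0 alg_mpolyC.
  by rewrite mderivZ mderivX mnm1E (negPf ji) scale0r scaler0.
elim: D => [|D IHD]; first by rewrite expr0 -mpolyC1 mderivC mul0r scale0r.
rewrite exprS mderivM dl IHD mul_mpolyC -scalerAr /=.
case: D {IHD} => [|D] /=; first by rewrite expr0 !mul0r scale0r addr0 mul1r.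
rewrite -exprS -scalerDl; congr (_ *: _); by rewrite -[in RHS]natr1 mulrDl mul1r addrC.
Qed.

Lemma mderivm_lformX u m D : (lform u ^+ D)^`M[m] =
  ((D ^_ (mdeg m))%:R * \prod_i u i ^+ m i) *: lform u ^+ (D - mdeg m).
Proof.
have [k] := ubnP (mdeg m); elim: k m => // k IHk m /ltnSE le_k.
have [->|m0] := eqVneq m 0%MM.
  rewrite mderivm0m mdeg0 ffactn0 subn0 big1 ?mulr1 ?scale1r // => i _.
  by rewrite mnm0E expr0.
have [i mi] : exists i, m i != 0%N.
  apply: contrapT => /forallNP z; case/eqP: m0; apply/mnmP => j.
  by rewrite mnm0E; apply/eqP; rewrite -[_ == _]negbK; apply/negP/z.
have -> : m = (m - U_(i) + U_(i))%MM by rewrite submK // lep1mP.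
set m' := (m - U_(i))%MM.
have dm : mdeg m = (mdeg m').+1.
  by rewrite -[in LHS](@submK _ U_(i) m) ?lep1mP // mdegD mdeg1 addn1.
have lt' : (mdeg m' < k)%N by rewrite -dm.
rewrite mderivmDm mderivmU1m (IHk m' lt') mderivZ mderiv_lformX scalerA.
rewrite mdegD mdeg1 addn1 ffactnSr subnS; congr (_ *: _).
rewrite natrM -!mulrA; congr (_ * _); rewrite mulrCA; congr (_ * _).
rewrite (bigD1 i) //= [RHS](bigD1 i) //= mnmDE mnm1E eqxx addn1 exprS.
rewrite mulrC mulrA; congr (_ * _); apply: eq_bigr => j ji.
by rewrite mnmDE mnm1E eq_sym (negPf ji) addn0.
Qed.

Lemma apolar_lformX a u D : a \is D.-homog ->
  apolar a (lform u ^+ D) = D`!%:R * a.@[u].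
Proof.
move=> ha; rewrite mevalE big_distrr /apolar; apply: eq_big_seq => m ma.
rewrite mderivm_lformX (dhomog_mf ha ma) subnn expr0 mcoeffZ mcoeff1 eqxx mulr1.
by rewrite ffactnn mulrCA.
Qed.

Definition mfact (m : 'X_{1..N}) : nat := \prod_i (m i)`!.

Lemma mcoeff0_mderivm m b : (b^`M[m])@_0%MM = b@_m *+ mfact m.
Proof.
rewrite mcoeff_mderivm addm0; congr (_ *+ _); apply: eq_bigr => i _.
exact: ffactnn.
Qed.

Lemma mfact_neq0 m : (mfact m)%:R != 0 :> K.
Proof.
by rewrite pnatr_eq0 -lt0n; apply: prodn_gt0 => i; exact: fact_gt0.
Qed.

Lemma apolarwE k a b : (msize a <= k)%N ->
  apolar a b = \sum_(m : 'X_{1..N < k}) a@_m * (b@_m *+ mfact m).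
Proof.
move=> le_k; pose I : subFinType _ := 'X_{1..N < k}.
rewrite /apolar (big_mksub I) //=; first last.
- by move=> x /msize_mdeg_lt /leq_trans /(_ le_k) ->.
- by rewrite msupp_uniq.
rewrite big_rmcond /=; last by move=> m /memN_msupp_eq0 ->; rewrite mul0r.
by apply: eq_bigr => m _; rewrite mcoeff0_mderivm.
Qed.

(** The sum of the [m! a_m^2] has no cancellation for real coefficients; it is applied to powers of
    the determinant, which have integer ones. *)
Lemma apolar_self_neq0 a : (forall m, a@_m \is Num.real) -> a != 0 -> apolar a a != 0.
Proof.
move=> ra a0; rewrite /apolar.
have pos m : 0 <= a@_m * (a^`M[m])@_0%MM.
  by rewrite mcoeff0_mderivm mulrnAr mulrn_wge0 // -expr2 real_exprn_even_ge0.
rewrite psumr_neq0 //; apply/hasP; exists (mlead a); first exact: mlead_supp.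
rewrite lt_def pos andbT mcoeff0_mderivm mulrnAr -mulr_natr mulf_neq0 ?mfact_neq0 //.
by rewrite mulf_neq0 ?mleadc_eq0.
Qed.

Lemma lformX_homog u D : lform u ^+ D \is D.-homog.
Proof.
rewrite -[X in X.-homog]mul1n; apply: dhomogMn; apply: rpred_sum => i _.
by apply: rpredZ; rewrite dhomogX /= mdeg1.
Qed.

(* A linear form vanishing on all [D]-th powers is given by the apolar pairing with
   some form [a], whose values are then all zero. *)
Lemma lformX_span D (F : {mpoly K[N]}) : F \is D.-homog -> exists (q : nat) (c : 'I_q -> K)
  (u : 'I_q -> 'I_N -> K), F = \sum_i c i *: lform (u i) ^+ D.
Proof.
move=> hF; pose T : finType := 'X_{1..N < D.+1}.
pose ev (j : 'I_#|T|) : 'X_{1..N < D.+1} := enum_val j.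
pose vec b : 'rV[K]_#|T| := \row_j b@_(ev j).
pose A q (l : 'I_q -> 'I_N -> K) := \matrix_(i < q) vec (lform (l i) ^+ D).
have ltT b m : b \is D.-homog -> (D < mdeg m)%N -> b@_m = 0.
  by move=> hb lt; rewrite (dhomog_nemf_coeff hb) // gtn_eqF.
have vecP b b' : b \is D.-homog -> b' \is D.-homog -> vec b = vec b' -> b = b'.
  move=> hb hb' /rowP e; apply/mpolyP => m.
  have [lt|ge] := ltnP D (mdeg m); first by rewrite !ltT.
  have := e (enum_rank (BMultinom (ge : (mdeg m < D.+1)%N))).
  by rewrite !mxE /ev enum_rankK.
have exr : exists r, `[< exists q (l : 'I_q -> 'I_N -> K), \rank (A q l) = r >].
  by exists (\rank (A 0%N (fun _ _ => 0))); apply/asboolP; do 2!eexists.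
have bnd r : `[< exists q (l : 'I_q -> 'I_N -> K), \rank (A q l) = r >] -> (r <= #|T|)%N.
  by move=> /asboolP[q [l <-]]; exact: rank_leq_col.
case: (ex_maxnP exr bnd) => r /asboolP[q [l rl]] maxr.
have inA u : (vec (lform u ^+ D) <= A q l)%MS.
  pose l' (i : 'I_q.+1) := if unlift ord_max i is Some j then l j else u.
  have sub : (A q l <= A q.+1 l')%MS.
    apply/row_subP => i; apply: eq_row_sub (lift ord_max i) _.
    by rewrite !rowK /l' liftK.
  have [le eq] := mxrank_leqif_sup sub.
  have : (A q.+1 l' <= A q l)%MS.
    rewrite -eq eqn_leq le rl; apply: maxr; apply/asboolP; by do 2!eexists.
  move/row_subP/(_ ord_max); by rewrite rowK /l' unlift_none.
have FA : (vec F <= A q l)%MS.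
  rewrite submxE; apply: contraT => /eqP/rowP nz.
  case: nz => j; rewrite [RHS]mxE; pose lam m := (cokermx (A q l)) m j.
  (* A column of [cokermx] is a linear form vanishing on the row space; dividing its entries by [m!]
     makes it the pairing with [a]. *)
  pose a := \sum_(i : 'I_#|T| | mdeg (ev i) == D) (lam i / (mfact (ev i))%:R) *: 'X_[ev i].
  have ha : a \is D.-homog.
    by apply: rpred_sum => i /eqP di; apply: rpredZ; rewrite dhomogX /= di.
  have sa : (msize a <= D.+1)%N.
    by rewrite msizeE; apply/bigmax_leqP_seq => m ma _; rewrite (dhomog_mf ha ma).
  have acoef i : mdeg (ev i) = D -> a@_(ev i) = lam i / (mfact (ev i))%:R.
    move=> di; rewrite raddf_sum (bigD1 i) ?di //= big1 => [|k /andP[_ ki]].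
      by rewrite mcoeffZ mcoeffX eqxx mulr1 addr0.
    by rewrite mcoeffZ mcoeffX (inj_eq val_inj) (inj_eq enum_val_inj) (negPf ki) mulr0.
  have aE b : b \is D.-homog -> apolar a b = (vec b *m cokermx (A q l)) 0 j.
    move=> hb; rewrite (apolarwE _ sa) (reindex (@enum_val _ T)) /=; last first.
      by apply: onW_bij; exact: enum_val_bij.
    rewrite mxE; apply: eq_bigr => i _; rewrite mxE -/(ev i) -/(lam i).
    have [di|nd] := eqVneq (mdeg (ev i)) D.
      by rewrite acoef // -[b@__ *+ _]mulr_natr mulrA mulrAC divfK ?mfact_neq0 // mulrC.
    by rewrite (dhomog_nemf_coeff hb nd) mul0rn mulr0 mul0r.
  have a0 : a = 0.
    apply: (mpoly_eval_inj (@pchar_num K)) => u; rewrite meval0.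
    have := apolar_lformX u ha; rewrite aE ?lformX_homog //.
    have := inA u; rewrite submxE => /eqP ->; rewrite mxE => /esym/eqP.
    by rewrite mulf_eq0 pnatr_eq0 -[_ == 0%N]negbK -lt0n fact_gt0 => /eqP.
  by rewrite -aE // a0 /apolar msupp0 big_nil.
have [c cE] := submxP FA; exists q, (fun i => c 0 i), l.
apply: vecP => //; first by apply: rpred_sum => i _; apply: rpredZ; exact: lformX_homog.
rewrite cE; apply/rowP => j; rewrite !mxE raddf_sum; apply: eq_bigr => i _ /=.
by rewrite mcoeffZ !mxE.
Qed.

Lemma homog_of_scaling D (F : {mpoly K[N]}) : (forall (t : K) v, t != 0 ->
  F.@[fun i => t * v i] = t ^+ D * F.@[v]) -> F \is D.-homog.
Proof.
move=> sc; suff FE : pihomog mdeg D F = F by rewrite -FE pihomogP.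
apply: (mpoly_eval_inj (@pchar_num K)) => v.
pose q : {poly K} := \sum_(d < msize F) (pihomog mdeg d F).@[v] *: 'X^d.
have qE t : q.[t] = F.@[fun i => t * v i].
  rewrite [in RHS](pihomog_partitionE (leqnn (msize F))) raddf_sum horner_sum.
  apply: eq_bigr => d _ /=; rewrite hornerZ hornerXn !mevalE big_distrl.
  apply: eq_big_seq => m mf /=; rewrite -mulrA; congr (_ * _).
  rewrite -(dhomog_mf (pihomogP _ _ _) mf) /= mdegE expr_sum -big_split.
  by apply: eq_bigr => i _; rewrite exprMn mulrC.
have q2 : q = F.@[v] *: 'X^D.
  apply/eqP; rewrite -subr_eq0; apply: contraT => d0.
  have Xd0 : 'X * (q - F.@[v] *: 'X^D) != 0 by rewrite mulf_neq0 ?polyX_eq0.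
  have [s] := poly_neq0_eval (@pchar_num K) Xd0.
  rewrite hornerM hornerX hornerD hornerN hornerZ hornerXn qE.
  have [->|s0] := eqVneq s 0; first by rewrite mul0r eqxx.
  by rewrite sc // [s ^+ D * _]mulrC subrr mulr0 eqxx.
have := congr1 (fun p : {poly K} => p`_D) q2.
rewrite coefZ coefXn eqxx mulr1 => <-; rewrite coef_sum.
have [lt|ge] := ltnP D (msize F).
  rewrite (bigD1 (Ordinal lt)) //= big1 => [|d nd]; first by rewrite coefZ coefXn eqxx mulr1 addr0.
  by rewrite coefZ coefXn eq_sym -[D]/(val (Ordinal lt)) val_eqE (negPf nd) mulr0.
rewrite big1 => [|d _]; first by rewrite pihomog_big ?meval0.
by rewrite coefZ coefXn gtn_eqF ?mulr0 // (leq_trans (ltn_ord d)).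
Qed.

End Apolar.

(** * Semi-invariants and Pluecker coordinates *)

(** Cauchy-Binet before grouping: [f] runs over all maps, and each minor is later a signed Pluecker
    coordinate or zero. *)
Lemma det_mul_tr_expand (R : comNzRingType) (k M : nat) (U Q : 'M[R]_(k, M)) :
  \det (U *m Q^T) = \sum_(f : {ffun 'I_k -> 'I_M})
    (\prod_r U r (f r)) * \det (\matrix_(r, t) Q t (f r)).
Proof.
transitivity (\sum_(s : 'S_k) \sum_(f : {ffun 'I_k -> 'I_M})
    (-1) ^+ s * \prod_r (U r (f r) * Q (s r) (f r))).
  apply: eq_bigr => s _; rewrite -big_distrr /=; congr (_ * _).
  rewrite -(bigA_distr_bigA (fun r c => U r c * Q (s r) c)).
  by apply: eq_bigr => r _; rewrite mxE; apply: eq_bigr => c _; rewrite mxE.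
rewrite exchange_big; apply: eq_bigr => f _; rewrite big_distrr; apply: eq_bigr => s _ /=.
rewrite big_split mulrCA; congr (_ * (_ * _)).
by apply: eq_bigr => r _; rewrite mxE.
Qed.

Lemma increasing_factorization (k M : nat) (f : {ffun 'I_k -> 'I_M}) : injective f ->
  exists s : 'S_k, exists e : {ffun 'I_k -> 'I_M},
    (forall r, f r = e (s r)) /\ (forall r r' : 'I_k, (r < r')%N -> (e r < e r')%N).
Proof.
move=> inj_f; pose A := [set f r | r : 'I_k].
have cA : #|A| = k by rewrite card_imset // card_ord.
have sE : size (enum A) = k by rewrite -cardE.
have fA r : f r \in enum A by rewrite mem_enum; apply: imset_f.
have lt_ix r : (index (f r) (enum A) < k)%N by rewrite -[X in (_ < X)%N]sE index_mem.
have inj_s : injective (fun r => Ordinal (lt_ix r)).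
  move=> r r' /(congr1 val) /= e; apply: inj_f.
  by rewrite -[LHS](nth_index (f r) (fA r)) e nth_index.
pose e := [ffun r : 'I_k => nth (f r) (enum A) r].
exists (perm inj_s), e; split=> [r|r r' lt].
  by rewrite permE ffunE /= (set_nth_default (f r)) ?sE // nth_index.
rewrite !ffunE (set_nth_default (f r)) ?sE //.
have srt : sorted (relpre val ltn) (enum A).
  rewrite /(enum _) /enum_mem; apply: sorted_filter.
    by move=> a b c /=; apply: ltn_trans.
  rewrite -sorted_map.
  have -> : map val (Finite.enum 'I_M) = iota 0 M by rewrite -enumT val_enum_ord.
  exact: iota_ltn_sorted.
have := @sorted_ltn_nth _ (relpre val ltn) _ (f r) (enum A) srt r r'.
by rewrite !inE !sE !ltn_ord; apply=> // a b c /=; apply: ltn_trans.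
Qed.

Section Pluecker.
Variables (K : numFieldType) (n k : nat).
Local Notation M := #|mon2 n|.

Definition frame_mx (P : sym2_map K n k) : 'M[K]_(k, M) :=
  \matrix_(t, c) P t (mon2_nth c).1 (mon2_nth c).2.

Lemma plucker_frame P I : plucker P I =
  \det (\matrix_(r, t) frame_mx P t (val (enum_val I) r)).
Proof. by congr (\det _); apply/matrixP => r t; rewrite !mxE. Qed.

Lemma minor_plucker (f : {ffun 'I_k -> 'I_M}) :
  exists G : {mpoly K[#|plucker_ix n k|]}, G \is 1.-homog /\
    forall P, G.@[plucker P] = \det (\matrix_(r, t) frame_mx P t (f r)).
Proof.
have [inj|ninj] := pselect (injective f); last first.
  exists 0; split=> [|P]; first exact: dhomog0.
  rewrite meval0; have [r [r' [ne e]]] : exists r r', r != r' /\ f r = f r'.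
    apply: contrapT => none; apply: ninj => r r' e; apply/eqP; apply: contrapT => /negP ne.
    by apply: none; exists r, r'.
  by apply/esym/(determinant_alternate ne) => t; rewrite !mxE e.
have [s [e [fE incr]]] := increasing_factorization inj.
have eP : [forall r : 'I_k, forall r' : 'I_k, (r < r')%N ==> (e r < e r')%N].
  by apply/forallP => r; apply/forallP => r'; apply/implyP; apply: incr.
pose I : 'I_#|plucker_ix n k| := enum_rank (exist _ e eP : plucker_ix n k).
exists ((-1) ^+ s *: 'X_I); split=> [|P].
  by apply: rpredZ; rewrite dhomogX /= mdeg1.
rewrite mevalZ mevalXU plucker_frame enum_rankK /= -det_perm -det_mulmx -row_permE.
by congr (\det _); apply/matrixP => r t; rewrite !mxE fE.
Qed.

Lemma det_mul_frame_plucker (U : 'M[K]_(k, M)) :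
  exists G : {mpoly K[#|plucker_ix n k|]}, G \is 1.-homog /\
    forall P, G.@[plucker P] = \det (U *m (frame_mx P)^T).
Proof.
have [G GP] := choice minor_plucker.
exists (\sum_(f : {ffun 'I_k -> 'I_M}) (\prod_r U r (f r)) *: G f); split=> [|P].
  by apply: rpred_sum => f _; apply: rpredZ; case: (GP f).
rewrite det_mul_tr_expand raddf_sum; apply: eq_bigr => f _ /=.
by rewrite mevalZ; case: (GP f) => _ ->.
Qed.

Lemma meval_lform_mx (m q : nat) (U A : 'M[K]_(m, q)) :
  (lform (mxvec U 0)).@[mxvec A 0] = \tr (U *m A^T).
Proof.
rewrite meval_lform /mxtrace; under [RHS]eq_bigr do rewrite mxE.
rewrite pair_bigA (reindex (uncurry (@mxvec_index m q))) /=; last first.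
  by case: (curry_mxvec_bij m q) => g; exists g.
by apply: eq_bigr => -[i j] _ /=; rewrite !mxvecE mxE.
Qed.

Definition det_mpoly : {mpoly K[k * k]} := \det (vec_mx (\row_j 'X_j) : 'M_k).

Lemma meval_det_mpoly v : det_mpoly.@[v] = \det (vec_mx (\row_j v j) : 'M_k).
Proof.
rewrite -det_map_mx; congr (\det _); apply/matrixP => i j; rewrite !mxE.
by rewrite /= mevalXU.
Qed.

Lemma det_mpoly_neq0 : det_mpoly != 0.
Proof.
apply/eqP => d0; have := meval_det_mpoly (mxvec 1%:M 0).
rewrite d0 meval0 (_ : \row_j _ = mxvec 1%:M); last by apply/rowP => j; rewrite mxE.
by rewrite mxvecK det1 => /eqP; rewrite eq_sym oner_eq0.
Qed.

Lemma det_mpoly_real d m : (det_mpoly ^+ d)@_m \is Num.real.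
Proof.
pose D : {mpoly int[k * k]} := \det (vec_mx (\row_j 'X_j) : 'M_k).
have -> : det_mpoly ^+ d = map_mpoly intr (D ^+ d).
  rewrite rmorphXn -det_map_mx; congr (\det _ ^+ _); apply/matrixP => i j.
  by rewrite !mxE /= map_mpolyX.
by rewrite mcoeff_map_mpoly realz.
Qed.

(* Pairing [g |-> F (g Q)] with [det ^ d] under the apolar form gives a nonzero
   multiple of [F Q]; for [F] a power of the linear form of matrix [U] it gives
   [det (U Q^T) ^ d], where [det (U Q^T)] is linear in the minors of [Q]. *)
Lemma semi_invariant_plucker (d : nat) (F : {mpoly K[k * M]}) :
  (forall g Q, g \in unitmx -> mxeval F (g *m Q) = \det g ^+ d * mxeval F Q) ->
  exists G : {mpoly K[#|plucker_ix n k|]}, G \is d.-homog /\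
    forall P, G.@[plucker P] = mxeval F (frame_mx P).
Proof.
(* The scalar matrix [t] has determinant [t ^+ k], so [F] has degree [k * d] in the entries. *)
move=> semi; pose D := (k * d)%N.
have hF : F \is D.-homog.
  apply: homog_of_scaling => t v t0.
  have := semi t%:M (vec_mx (\row_j v j)).
  rewrite unitmxE det_scalar unitfE expf_neq0 // -exprM mul_scalar_mx => /(_ isT).
  rewrite /mxeval linearZ /= vec_mxK => e.
  by rewrite -/D -(@meval_eq _ _ (fun j => (t *: \row_j v j) 0 j)) ?e => [|j];
    rewrite ?mxE //; congr (_ * _); apply: meval_eq => j; rewrite mxE.
have [q [c [u FE]]] := lformX_span hF.
pose a := det_mpoly ^+ d.
have ha : a \is D.-homog.
  apply: homog_of_scaling => t v _; rewrite /a !rmorphXn /= !meval_det_mpoly.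
  rewrite (_ : \row_j (t * v j) = t *: \row_j v j); last by apply/rowP => j; rewrite !mxE.
  by rewrite linearZ /= detZ exprMn -exprM.
have a0 : a != 0 by rewrite expf_neq0 // det_mpoly_neq0.
have aa : apolar a a != 0.
  by apply: apolar_self_neq0 => // m; exact: det_mpoly_real.
pose U i : 'M[K]_(k, M) := vec_mx (\row_j u i j).
have uE i : u i =1 mxvec (U i) 0 by move=> j; rewrite vec_mxK mxE.
have [G GP] := choice (fun i => det_mul_frame_plucker (U i)).
exists (\sum_i (c i * D`!%:R / apolar a a) *: G i ^+ d); split=> [|P].
  apply: rpred_sum => i _; apply: rpredZ.
  by have := dhomogMn d (GP i).1; rewrite mul1n.
set Q := frame_mx P.
(* [b] is [g |-> F (g Q)], since [tr (U (g Q)^T) = tr (U Q^T g^T)] is linear in [g] with matrix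
   [U Q^T]. *)
pose b := \sum_i c i *: lform (mxvec (U i *m Q^T) 0) ^+ D.
have lformE i v : (lform (u i)).@[v] = (lform (mxvec (U i) 0)).@[v].
  by rewrite !meval_lform; apply: eq_bigr => j _; rewrite uE.
have bE : b = mxeval F Q *: a.
  (* Semi-invariance is known for invertible [g] only; after multiplication by the determinant both
     sides agree everywhere. *)
  apply: (mulIf det_mpoly_neq0); apply: (mpoly_eval_inj (@pchar_num K)) => v.
  rewrite !mevalM mevalZ /a rmorphXn /= meval_det_mpoly; set g := vec_mx _.
  have [ug|nug] := boolP (g \in unitmx); last first.
    by move: nug; rewrite unitmxE unitfE negbK => /eqP ->; rewrite !mulr0.
  congr (_ * _); rewrite mulrC -semi // /mxeval FE !raddf_sum; apply: eq_bigr => i _ /=.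
  rewrite !mevalZ !rmorphXn /= lformE; congr (_ * _ ^+ _).
  rewrite meval_lform_mx trmx_mul mulmxA.
  rewrite -meval_lform_mx; apply: meval_eq => j.
  by rewrite /g vec_mxK mxE.
have := congr1 (apolar a) bE; rewrite apolarZ apolar_sum => e.
apply: (mulIf aa); rewrite -e raddf_sum big_distrl; apply: eq_bigr => i _ /=.
rewrite apolarZ apolar_lformX // mevalZ rmorphXn /= (GP i).2 mulrAC divfK // -mulrA.
congr (_ * (_ * _)); rewrite /a rmorphXn /= meval_det_mpoly.
rewrite (_ : \row_j _ = mxvec (U i *m Q^T)) ?mxvecK //.
by apply/rowP => j; rewrite mxE.
Qed.

End Pluecker.

(** * Uncountability of the complex numbers *)

Lemma avoid_seq (R : realFieldType) (s : seq R) (I : R * R) : I.1 < I.2 ->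
  exists I' : R * R, [/\ I.1 <= I'.1, I'.1 < I'.2, I'.2 <= I.2 &
    forall x, x \in s -> ~~ (I'.1 <= x <= I'.2)].
Proof.
move=> I12; elim: s => [|x s [[a b] /= [le1 lt12 le2 av]]]; first by exists I; split.
pose c := (a + b) / 2.
have ac : a < c by rewrite midf_lt.
have cb : c < b by rewrite midf_lt.
have [xc|cx] := ltP x c.
  exists (c, b); split=> //=; first exact: le_trans le1 (ltW ac).
  move=> y; rewrite inE => /orP[/eqP ->|/av]; first by rewrite leNgt xc.
  by apply: contra => /andP[cy ->]; rewrite andbT (le_trans (ltW ac)).
pose d := (a + c) / 2.
have ad : a < d by rewrite midf_lt.
have dc : d < c by rewrite midf_lt.
exists (a, d); split=> //=; first exact: le_trans (ltW (lt_trans dc cb)) le2.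
move=> y; rewrite inE => /orP[/eqP ->|/av].
  by rewrite negb_and -!ltNge (lt_le_trans dc cx) orbT.
by apply: contra => /andP[-> yd]; rewrite /= (le_trans yd) // ltW // (lt_trans dc cb).
Qed.

(** Cantor's nested intervals: were the fibres of [m] finite, [J k.+1] could avoid the fibre over
    [k], yet the supremum [x] of the left ends lies in [J (m x).+1]. *)
Lemma uncountable_real (R : realType) : uncountable_type R.
Proof.
move=> m; apply: contrapT => /forallNP fin.
have /choice[s sP] : forall D, exists s : seq R, forall x, m x = D -> x \in s.
  move=> D; have /existsNP[N noN] := fin D.
  pose P k := `[< exists s : seq R, [/\ uniq s, size s = k & forall a, a \in s -> m a = D] >].
  have exP : exists k, P k by exists 0%N; apply/asboolP; exists [::].
  have bnd k : P k -> (k <= N)%N.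
    move=> /asboolP[t [ut st mt]]; rewrite leqNgt; apply/negP => lt.
    apply: noN; exists (take N t); split; first exact: take_uniq.
      by rewrite size_takel // st ltnW.
    by move=> a /mem_take; apply: mt.
  case: (ex_maxnP exP bnd) => k /asboolP[t [ut st mt]] maxk.
  exists t => x mx; apply: contraT => xt.
  have /maxk : P k.+1.
    apply/asboolP; exists (x :: t); split; rewrite /= ?xt ?st //.
    by move=> a; rewrite inE => /orP[/eqP ->|/mt].
  by rewrite ltnn.
have /choice[next nextP] : forall DI : nat * (R * R), exists I' : R * R, DI.2.1 < DI.2.2 ->
   [/\ DI.2.1 <= I'.1, I'.1 < I'.2, I'.2 <= DI.2.2 &
    forall x, x \in s DI.1 -> ~~ (I'.1 <= x <= I'.2)].
  move=> [D I] /=; have [lt|nlt] := pselect (I.1 < I.2); last by exists I.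
  by have [I' ?] := avoid_seq (s D) lt; exists I'.
pose J := fix J k : R * R := if k is k'.+1 then next (k', J k') else (0, 1).
have Jlt k : (J k).1 < (J k).2.
  by elim: k => [|k IHk] /=; [exact: ltr01|case: (nextP (k, J k) IHk)].
have step k : [/\ (J k).1 <= (J k.+1).1, (J k.+1).2 <= (J k).2 &
    forall x, x \in s k -> ~~ ((J k.+1).1 <= x <= (J k.+1).2)].
  by case: (nextP (k, J k) (Jlt k)).
have Jmono k l : (k <= l)%N -> (J k).1 <= (J l).1 /\ (J l).2 <= (J k).2.
  move=> /subnK <-; elim: (l - k)%N => [|i [IH1 IH2]]; first by rewrite add0n.
  by rewrite addSn; case: (step (i + k)%N) => st1 st2 _; split;
    [exact: le_trans IH1 st1|exact: le_trans st2 IH2].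
have Jcross k l : (J k).1 <= (J l).2.
  have [kl|lk] := leqP k l; first exact: le_trans (Jmono _ _ kl).1 (ltW (Jlt l)).
  exact: le_trans (ltW (Jlt k)) (Jmono _ _ (ltnW lk)).2.
pose E : set R := [set x | exists k, x = (J k).1]%classic.
have E0 : (E !=set0)%classic by exists (J 0%N).1; exists 0%N.
have ubE k : ubound E (J k).2 by move=> _ [l ->].
have supE : has_sup E by split=> //; exists (J 0%N).2.
pose x := sup E; have [_ _ /(_ x (sP _ _ erefl))/negP[]] := step (m x).
apply/andP; split; first by apply: sup_upper_bound => //; exists (m x).+1.
exact: ge_sup.
Qed.

Lemma uncountable_complex (R : realType) : uncountable_type (complex R).
Proof.
move=> m; have [D DP] := uncountable_real (fun x : R => m (x%:C)%C).
exists D => N; have [s [us ss ms]] := DP N; exists [seq (x%:C)%C | x <- s]; split.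
- by rewrite map_inj_uniq // => x y [].
- by rewrite size_map.
- by move=> _ /mapP[x xs ->]; apply: ms.
Qed.

(** * Symmetric matrices of rank at most 4 *)

(** Lagrange's reduction: for [v] with [a = v A v^T] nonzero, subtracting the square of the linear
    form [v A / sqrt a] leaves [A'], with rows in the span of those of [A] but killing [v]; so the
    rank drops. *)
Lemma symmetric_gram (C : numClosedFieldType) (r n : nat) (A : 'M[C]_n) :
  A^T = A -> (\rank A <= r)%N -> exists Y : 'M[C]_(r, n), A = Y^T *m Y.
Proof.
elim: r A => [|r IHr] A symA.
  rewrite leqn0 mxrank_eq0 => /eqP ->.
  by exists 0; rewrite mulmx0.
move=> rkA; have [->|A0] := eqVneq A 0; first by exists 0; rewrite mulmx0.
have [v va] : exists v : 'rV[C]_n, (v *m A *m v^T) 0 0 != 0.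
  apply: contrapT => /forallNP none; case/eqP: A0; apply/matrixP => i j.
  have q0 (v : 'rV[C]_n) : (v *m A *m v^T) 0 0 = 0.
    by apply/eqP; rewrite -[_ == _]negbK; apply/negP/none.
  have := q0 (delta_mx 0 i + delta_mx 0 j).
  rewrite linearD /= !mulmxDl !mulmxDr [LHS]mxE [X in X + _]mxE [X in _ + X]mxE !q0.
  have e k l : (delta_mx 0 k *m A *m (delta_mx 0 l)^T : 'M_1) 0 0 = A k l.
    by rewrite -rowE trmx_delta -colE !mxE.
  rewrite !e add0r addr0 -[in A j i]symA [A^T _ _]mxE -mulr2n => /eqP.
  by rewrite mulrn_eq0 /= mxE => /eqP.
set a := (v *m A *m v^T) 0 0 in va.
have aE : v *m A *m v^T = a%:M by rewrite [LHS]mx11_scalar.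
have vAT : (v *m A)^T = A *m v^T by rewrite trmx_mul symA.
pose A' := A - a^-1 *: (A *m v^T *m (v *m A)).
have symA' : A'^T = A'.
  by rewrite /A' linearB linearZ /= trmx_mul vAT [(A *m v^T)^T]trmx_mul trmxK symA.
have vA' : A' *m v^T = 0.
  rewrite /A' mulmxBl -scalemxAl -[A *m v^T *m (v *m A) *m v^T]mulmxA aE mul_mx_scalar scalerA mulVf //.
  by rewrite scale1r subrr.
have sub : (A' < A)%MS.
  rewrite ltmxE; apply/andP; split.
    by apply: addmx_sub => //; rewrite eqmx_opp scalemx_sub // mulmxA submxMl.
  apply/negP => /submxP[Z AZ]; move: va; rewrite /a -mulmxA {1}AZ.
  by rewrite -mulmxA vA' !mulmx0 mxE eqxx.
have [|Y' Y'E] := IHr A' symA'.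
  by rewrite -ltnS (leq_trans (rank_ltmx sub)).
pose Z : 'M_(1 + r, n) := col_mx ((sqrtC a)^-1 *: (v *m A)) Y'.
suff AZ : A = Z^T *m Z by exists Z.
rewrite /Z tr_col_mx mul_row_col -Y'E [(_ *: _)^T]linearZ /= -scalemxAl -scalemxAr scalerA vAT.
by rewrite -expr2 exprVn sqrtCK addrC /A' subrK.
Qed.

Section SymmetricMatrices.
Variables (K : numClosedFieldType) (n : nat).
Local Notation M := #|mon2 n|.

Lemma sort_pair_proof (a b : 'I_n) :
  ((if (a <= b)%N then (a, b) else (b, a)).1 <= (if (a <= b)%N then (a, b) else (b, a)).2)%N.
Proof. by case: (leqP a b) => [|/ltnW]. Qed.

Definition mon2_index (a b : 'I_n) : 'I_M :=
  enum_rank (exist (fun ab : 'I_n * 'I_n => is_true (ab.1 <= ab.2)%N) _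
    (sort_pair_proof a b) : mon2 n).

Lemma mon2_index_nth (c : 'I_M) : mon2_index (mon2_nth c).1 (mon2_nth c).2 = c.
Proof.
rewrite /mon2_nth -[RHS]enum_valK; congr enum_rank; apply: val_inj => /=.
by case: (enum_val c) => -[a b] /= ->.
Qed.

Lemma mon2_nth_index (a b : 'I_n) :
  mon2_nth (mon2_index a b) = if (a <= b)%N then (a, b) else (b, a).
Proof. by rewrite /mon2_nth enum_rankK. Qed.

Lemma mon2_indexC (a b : 'I_n) : mon2_index a b = mon2_index b a.
Proof.
congr enum_rank; apply: val_inj => /=.
by case: (ltngtP a b) => // /val_inj ->.
Qed.

Definition mult2 (a b : 'I_n) : K := if a == b then 1 else 2.

Lemma mult2_neq0 a b : mult2 a b != 0.
Proof. by rewrite /mult2; case: ifP; rewrite ?oner_neq0 ?pnatr_eq0. Qed.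

Lemma mult2C a b : mult2 a b = mult2 b a.
Proof. by rewrite /mult2 eq_sym. Qed.

Lemma sum_symmetric (f : 'I_n -> 'I_n -> K) : (forall a b, f a b = f b a) ->
  \sum_a \sum_b f a b =
  \sum_(c < M) mult2 (mon2_nth c).1 (mon2_nth c).2 * f (mon2_nth c).1 (mon2_nth c).2.
Proof.
move=> fC; pose G (x : 'I_n * 'I_n) := mult2 x.1 x.2 * f x.1 x.2.
transitivity (\sum_(x : 'I_n * 'I_n | (x.1 <= x.2)%N) G x); last first.
  rewrite (big_sub (fun x : 'I_n * 'I_n => (x.1 <= x.2)%N)) /=.
  rewrite (reindex (@enum_val (mon2 n) (mon2 n))) //=.
  by apply: onW_bij; exact: enum_val_bij.
rewrite pair_bigA (bigID (fun x : 'I_n * 'I_n => (x.1 <= x.2)%N)) /=.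
rewrite [X in _ + X](reindex (fun x : 'I_n * 'I_n => (x.2, x.1))) /=; last first.
  by exists (fun x : 'I_n * 'I_n => (x.2, x.1)) => -[a b].
rewrite [X in _ + X](eq_bigl (fun x : 'I_n * 'I_n => (x.1 <= x.2)%N && (x.1 < x.2)%N)); last first.
  by move=> x; rewrite -ltnNge; apply/idP/andP => [lt|[]//]; split; rewrite // ltnW.
rewrite big_mkcondr -big_split; apply: eq_bigr => -[a b] /= le_ab.
rewrite /G /mult2 /= -val_eqE ltn_neqAle le_ab andbT fC /=.
by case: eqP => _ /=; rewrite ?addr0 ?mul1r // mulr_natl mulr2n.
Qed.

Definition sym_of (x : 'cV[K]_M) : 'M[K]_n :=
  \matrix_(a, b) (x (mon2_index a b) 0 / mult2 a b).

Lemma sym_of_sym x : (sym_of x)^T = sym_of x.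
Proof. by apply/matrixP => a b; rewrite !mxE mon2_indexC mult2C. Qed.

Lemma sym_of_nth x c : mult2 (mon2_nth c).1 (mon2_nth c).2 *
  sym_of x (mon2_nth c).1 (mon2_nth c).2 = x c 0.
Proof. by rewrite mxE mon2_index_nth mulrC divfK ?mult2_neq0. Qed.

Lemma sum_sym_of x (S : 'M[K]_n) : S^T = S ->
  \sum_a \sum_b sym_of x a b * S a b =
  \sum_c x c 0 * S (mon2_nth c).1 (mon2_nth c).2.
Proof.
move=> symS; rewrite (@sum_symmetric (fun a b => sym_of x a b * S a b)) => [|a b].
  by apply: eq_bigr => c _; rewrite mulrA sym_of_nth.
by rewrite -[in RHS]sym_of_sym -[in RHS]symS !mxE.
Qed.

Lemma sym_of_eq0 x : (sym_of x == 0) = (x == 0).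
Proof.
apply/eqP/eqP => [x0|->]; last by apply/matrixP => a b; rewrite !mxE mul0r.
by apply/colP => c; rewrite -sym_of_nth x0 !mxE mulr0.
Qed.

(* The linear form [\sum_(a, b) A a b S a b] of a symmetric matrix [S] has, on the
   entries [S a b] with [a <= b], the coefficients [mult2 a b * A a b]. *)
Definition gram_coord (c : 'I_M) : {mpoly K[4 * n]} :=
  mult2 (mon2_nth c).1 (mon2_nth c).2 *:
  \sum_(r < 4) 'X_(mxvec_index r (mon2_nth c).1) * 'X_(mxvec_index r (mon2_nth c).2).

Definition gram_coords : M.-tuple {mpoly K[4 * n]} := [tuple gram_coord c | c < M].

Lemma gram_coords_homog c : tnth gram_coords c \is 2.-homog.
Proof.
rewrite tnth_mktuple; apply: rpredZ; apply: rpred_sum => r _.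
by rewrite -mpolyXD dhomogX /= mdegD !mdeg1.
Qed.

Lemma sym_of_gram (y : 'I_(4 * n) -> K) (Y := vec_mx (\row_j y j) : 'M_(4, n)) :
  sym_of (cone_point gram_coords y) = Y^T *m Y.
Proof.
apply/matrixP => a b; rewrite !mxE tnth_mktuple mevalZ mon2_nth_index.
have -> : mult2 (if (a <= b)%N then (a, b) else (b, a)).1
  (if (a <= b)%N then (a, b) else (b, a)).2 = mult2 a b.
  by case: ifP; rewrite // mult2C.
rewrite mulrC mulKf ?mult2_neq0 // raddf_sum; apply: eq_bigr => r _ /=.
rewrite mevalM !mevalXU !mxE; case: ifP => // _; exact: mulrC.
Qed.

Lemma mul_colE k (Q : 'M[K]_(k, M)) x t :
  (Q *m x : 'cV_k) t 0 = \sum_c x c 0 * Q t c.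
Proof. by rewrite mxE; apply: eq_bigr => c _; rewrite mulrC. Qed.

Lemma cone_point_eq0 (y : 'I_(4 * n) -> K) (Y := vec_mx (\row_j y j) : 'M_(4, n)) :
  (cone_point gram_coords y == 0) = (Y^T *m Y == 0).
Proof. by rewrite -sym_of_gram sym_of_eq0. Qed.

(* The cone is cut out by the forms [det (L A R)], [L : 'M_(5, n)], [R : 'M_(n, 5)]. *)
Lemma gram_coords_closed (x : 'I_M -> K) :
  (forall g : {mpoly K[M]}, g \mPo gram_coords = 0 -> g.@[x] = 0) ->
  exists y, forall c, x c = (tnth gram_coords c).@[y].
Proof.
move=> xP; pose A := sym_of (\col_c x c).
have [Y AY] : exists Y : 'M[K]_(4, n), A = Y^T *m Y.
  apply: symmetric_gram; first exact: sym_of_sym.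
  rewrite leqNgt; apply/negP => rk.
  (* By the rank normal form, [L A R] is the identity of size 5. On the cone, [Y^T Y] factors
     through dimension 4 and the determinant vanishes. *)
  pose L : 'M[K]_(5, n) := pid_mx 5 *m invmx (col_ebase A).
  pose R : 'M[K]_(n, 5) := invmx (row_ebase A) *m pid_mx 5.
  have LAR : L *m A *m R = 1%:M.
    rewrite -[in LHS](mulmx_ebase A) /L /R !mulmxA mulmxKV ?col_ebase_unit //.
    rewrite mulmxK ?row_ebase_unit // !mul_pid_mx.
    have le_n : (5 <= n)%N by apply: leq_trans rk (rank_leq_row _).
    by rewrite (_ : minn _ _ = 5%N) ?pid_mx_1 //; lia.
  pose Ag : 'M[{mpoly K[M]}]_n :=
    \matrix_(a, b) ((mult2 a b)^-1 *: 'X_(mon2_index a b)).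
  pose g := \det (map_mx (@mpolyC M K) L *m Ag *m map_mx (@mpolyC M K) R).
  have mapC m q v (B : 'M[K]_(m, q)) : map_mx (meval v) (map_mx (@mpolyC M K) B) = B.
    by apply/matrixP => a b; rewrite !mxE /= mevalC.
  have gE v : g.@[v] = \det (L *m sym_of (\col_c v c) *m R).
    rewrite /g -det_map_mx !map_mxM /= !mapC; congr (\det (_ *m _ *m _)).
    by apply/matrixP => a b; rewrite !mxE /= mevalZ mevalXU mulrC.
  suff /xP/eqP : g \mPo gram_coords = 0 by rewrite gE -/A LAR det1 oner_eq0.
  apply: (mpoly_eval_inj (@pchar_num K)) => y; rewrite meval0 comp_mpoly_meval gE.
  rewrite -/(cone_point gram_coords y) sym_of_gram; set Y := vec_mx _.
  apply/eqP; rewrite -[_ == 0]negbK -unitfE -unitmxE -row_full_unit /row_full neq_ltn.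
  apply/orP; left; apply: leq_ltn_trans (_ : 4 < 5)%N => //.
  rewrite mulmxA -mulmxA; exact: leq_trans (mxrankM_maxl _ _) (rank_leq_col _).
exists (mxvec Y 0) => c; transitivity ((\col_i x i : 'cV[K]_M) c 0); first by rewrite mxE.
rewrite -sym_of_nth -/A AY.
have eY : vec_mx (\row_j mxvec Y 0 j) = Y.
  by rewrite (_ : \row_j _ = mxvec Y) ?mxvecK //; apply/rowP => j; rewrite mxE.
have := sym_of_gram (mxvec Y 0); rewrite eY => <-.
by rewrite sym_of_nth mxE.
Qed.

Lemma meets_gramP k (P : sym2_map K n k) : (forall t, (P t)^T = P t) ->
  meets_cone gram_coords (frame_mx P) <->
  exists2 Y : 'M[K]_(4, n), Y^T *m Y != 0 &
    forall t, \sum_a \sum_b (Y^T *m Y) a b * P t a b = 0.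
Proof.
move=> symP.
have E y t : (frame_mx P *m cone_point gram_coords y) t 0 =
    \sum_a \sum_b sym_of (cone_point gram_coords y) a b * P t a b.
  rewrite mul_colE sum_sym_of //; apply: eq_bigr => c _.
  by rewrite [frame_mx _ _ _]mxE.
split=> [[y y0 Py]|[Y Y0 PY]].
  exists (vec_mx (\row_j y j)); first by rewrite -cone_point_eq0.
  by move=> t; rewrite -sym_of_gram -E Py mxE.
have eY : vec_mx (\row_j mxvec Y 0 j) = Y.
  by rewrite (_ : \row_j _ = mxvec Y) ?mxvecK //; apply/rowP => j; rewrite mxE.
exists (mxvec Y 0); first by rewrite cone_point_eq0 eY.
by apply/colP => t; rewrite E sym_of_gram eY PY mxE.
Qed.

End SymmetricMatrices.

(* Row by row numbering of the pairs [a <= b < n] with [a < 4], and its inverse. *)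
Definition pair_code (n a b : nat) : nat :=
  match a with
  | 0 => b
  | 1 => n + (b - 1)
  | 2 => (2 * n - 1) + (b - 2)
  | _ => (3 * n - 3) + (b - 3)
  end%N.

Definition pair_fst (n j : nat) : nat :=
  if (j < n)%N then 0%N else if (j < 2 * n - 1)%N then 1%N
  else if (j < 3 * n - 3)%N then 2%N else 3%N.

Definition pair_snd (n j : nat) : nat :=
  (if j < n then j else if j < 2 * n - 1 then j - n + 1
  else if j < 3 * n - 3 then j - (2 * n - 1) + 2 else j - (3 * n - 3) + 3)%N.

(** The four rows have lengths [n], [n - 1], [n - 2], [n - 3], in total [4 * n - 6], the dimension
    of the cone. *)
Lemma pair_codeP (n j : nat) : (3 < n)%N -> (j < 4 * n - 6)%N ->
  [/\ (pair_fst n j < 4)%N, (pair_fst n j <= pair_snd n j)%N, (pair_snd n j < n)%N &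
     pair_code n (pair_fst n j) (pair_snd n j) = j].
Proof.
rewrite /pair_fst /pair_snd => n3 jlt.
by case: ifP => ?; [|case: ifP => ?; [|case: ifP => ?]]; split; rewrite /pair_code; lia.
Qed.

Lemma pair_codeK (n a b : nat) : (3 < n)%N -> (a < 4)%N -> (a <= b)%N -> (b < n)%N ->
  [/\ (pair_code n a b < 4 * n - 6)%N, pair_fst n (pair_code n a b) = a &
      pair_snd n (pair_code n a b) = b].
Proof.
move=> n3 a4 ab bn; rewrite /pair_fst /pair_snd.
by case: a a4 ab => [|[|[|[|]]]] //= _ ab; split; do ?[case: ifP => ?]; lia.
Qed.

Section Independence.
Variables (K : numClosedFieldType) (m r : nat).
Hypothesis m_gt2 : (2 < m)%N.
Hypothesis r_eq : (r.+1 + 6 = 4 * m.+1)%N.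
Local Notation n := m.+1.

Definition gram_ix (j : 'I_r.+1) : 'I_#|mon2 n| :=
  mon2_index (inord (pair_fst n j)) (inord (pair_snd n j)).

Let code (a b : nat) : 'I_r.+1 := inord (pair_code n (minn a b) (maxn a b)).

(** The first four rows [E] of a symmetric matrix, with invertible leading block [B], can be
    prescribed freely: for [B = Z^T Z] and [Y = Z B^-1 E], the Gram matrix [E^T B^-1 E] extends
    them. So [h] vanishes wherever [del], the determinant of [B], does not. *)
Lemma gram_coords_indep (h : {mpoly K[r.+1]}) :
  h \mPo [tuple tnth (gram_coords K n) (gram_ix j) | j < r.+1] = 0 -> h = 0.
Proof.
move=> h0; have n3 : (3 < n)%N by [].
have kE : (4 * n - 6 = r.+1)%N by lia.
pose half (a b : nat) : K := if a == b then 1 else 2^-1.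
pose E (v : 'I_r.+1 -> K) : 'M[K]_(4, n) := \matrix_(a, b) (half a b * v (code a b)).
pose wd : 'I_4 -> 'I_n := widen_ord n3.
pose B v : 'M[K]_4 := \matrix_(a, b) E v a (wd b).
pose del : {mpoly K[r.+1]} := \det (\matrix_(a < 4, b < 4) (half a b *: 'X_(code a b))).
have delE v : del.@[v] = \det (B v).
  rewrite -det_map_mx; congr (\det _); apply/matrixP => a b; rewrite !mxE /=.
  by rewrite mevalZ mevalXU.
have del0 : del != 0.
  (* At the indicator of the diagonal, [B] is the identity. *)
  pose v0 (j : 'I_r.+1) : K := (pair_fst n j == pair_snd n j)%:R.
  suff B1 : B v0 = 1%:M.
    by apply: contraTneq (oner_neq0 K) => d0; rewrite -(det1 K 4) -B1 -delE d0 meval0 eqxx.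
  apply/matrixP => a b; rewrite !mxE /v0 /code /=.
  have a4 := ltn_ord a; have b4 := ltn_ord b.
  have [lt1 e1 e2] : [/\ (pair_code n (minn a b) (maxn a b) < 4 * n - 6)%N,
     pair_fst n (pair_code n (minn a b) (maxn a b)) = minn a b &
     pair_snd n (pair_code n (minn a b) (maxn a b)) = maxn a b].
    by apply: pair_codeK; lia.
  rewrite inordK -?kE // e1 e2 /half -val_eqE /=.
  have [->|ne] := eqVneq (val a) (val b); first by rewrite minnn maxnn eqxx mulr1.
  have {}ne : (a : nat) != b := ne.
  by rewrite (_ : (minn a b == maxn a b) = false) ?mulr0 //; lia.
suff : h * del = 0 by move/eqP; rewrite mulf_eq0 (negPf del0) orbF => /eqP.
apply: (mpoly_eval_inj (@pchar_num K)) => v; rewrite meval0 mevalM delE.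
have [->|dB] := eqVneq (\det (B v)) 0; first by rewrite mulr0.
have uB : B v \in unitmx by rewrite unitmxE unitfE.
have symB : (B v)^T = B v.
  by apply/matrixP => a b; rewrite !mxE /half /code /= eq_sym minnC maxnC.
have [Z BZ] := @symmetric_gram K 4 4 (B v) symB (rank_leq_row _).
pose Y := Z *m invmx (B v) *m E v.
have YY a b : (Y^T *m Y) (wd a) b = E v a b.
  have -> : Y^T *m Y = (E v)^T *m (invmx (B v) *m E v).
    rewrite /Y !trmx_mul trmx_inv symB !mulmxA; congr (_ *m _).
    by rewrite -[_ *m Z^T *m Z]mulmxA -BZ mulmxKV.
  transitivity ((B v *m (invmx (B v) *m E v)) a b); last by rewrite mulKVmx.
  rewrite mxE [RHS]mxE; apply: eq_bigr => c _; congr (_ * _).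
  by rewrite -[in RHS]symB !mxE.
have := congr1 (meval (mxvec Y 0)) h0; rewrite meval0 comp_mpoly_meval => hv.
rewrite (_ : h.@[v] = 0) ?mul0r // -[RHS]hv; apply: meval_eq => j; rewrite tnth_mktuple.
have [lt1 le12 lt2 cj] := @pair_codeP n j n3 (eq_ind_r (fun k => j < k)%N (ltn_ord j) kE).
set a : 'I_4 := Ordinal lt1; set b : 'I_n := Ordinal lt2.
have eix : gram_ix j = mon2_index (wd a) b.
  by congr mon2_index; apply: val_inj; rewrite /= inordK // (leq_trans lt1).
have nth_ix : mon2_nth (gram_ix j) = (wd a, b) by rewrite eix mon2_nth_index /= le12.
have eY : vec_mx (\row_i mxvec Y 0 i) = Y.
  by rewrite (_ : \row_i _ = mxvec Y) ?mxvecK //; apply/rowP => i; rewrite mxE.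
transitivity (cone_point (gram_coords K n) (mxvec Y 0) (gram_ix j) 0); last by rewrite mxE.
rewrite -sym_of_nth nth_ix /= sym_of_gram eY YY mxE /code /=.
rewrite (minn_idPl le12) (maxn_idPr le12) cj inord_val mulrA.
rewrite /mult2 /half -val_eqE /=; case: eqP => _; first by rewrite !mul1r.
by rewrite mulfV ?mul1r // pnatr_eq0.
Qed.

End Independence.

(** * Semistability of quotients of the symmetric square *)

Lemma trmx_sum_mul (R : comNzRingType) (n : nat) (A S : 'M[R]_n) :
  \sum_a \sum_b A a b * S a b = \tr (A *m S^T).
Proof.
by apply: eq_bigr => a _; rewrite mxE; apply: eq_bigr => b _; rewrite mxE.
Qed.

Lemma map_horner_polyC (R : comNzRingType) (p q : nat) (B : 'M[R]_(p, q)) s :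
  map_mx (horner_eval s) (map_mx polyC B) = B.
Proof. by apply/matrixP => i j; rewrite !mxE /horner_eval hornerC. Qed.

Section Semistability.
Variables (K : numClosedFieldType) (m r : nat).
Hypothesis uncK : uncountable_type K.
Hypothesis m_gt2 : (2 < m)%N.
Hypothesis r_eq : (r.+1 + 6 = 4 * m.+1)%N.
Local Notation n := m.+1.
Local Notation M := #|mon2 n|.
Local Notation meets := (meets_cone (gram_coords K n)).
Implicit Types (Q : 'M[K]_(r.+1, M)) (h : 'M[K]_n).

Definition unframe Q : sym2_map K n r.+1 := fun t => \matrix_(a, b) Q t (mon2_index a b).

Lemma unframe_sym Q t : (unframe Q t)^T = unframe Q t.
Proof. by apply/matrixP => a b; rewrite !mxE mon2_indexC. Qed.

Lemma unframeK Q : frame_mx (unframe Q) = Q.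
Proof. by apply/matrixP => t c; rewrite !mxE mon2_index_nth. Qed.

Definition sym2_act_mx h : 'M[K]_M := \matrix_(x, y)
  (h (mon2_nth y).1 (mon2_nth x).1 * h (mon2_nth y).2 (mon2_nth x).2 +
   (if (mon2_nth x).1 == (mon2_nth x).2 then 0 else
    h (mon2_nth y).1 (mon2_nth x).2 * h (mon2_nth y).2 (mon2_nth x).1)).

Lemma frame_act h (P : sym2_map K n r.+1) : (forall t, (P t)^T = P t) ->
  frame_mx (sym2_act h P) = frame_mx P *m sym2_act_mx h.
Proof.
move=> symP; apply/matrixP => t y; rewrite mxE [RHS]mxE.
set a := (mon2_nth y).1; set b := (mon2_nth y).2.
have PC c d : P t c d = P t d c by rewrite -[in LHS]symP mxE.
transitivity (\sum_c \sum_d (h a c * h b d + h a d * h b c) / 2 * P t c d).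
  have e1 : sym2_act h P t a b = \sum_c \sum_d h a c * h b d * P t c d.
    rewrite /sym2_act mxE exchange_big; apply: eq_bigr => d _.
    rewrite !mxE mulr_suml; apply: eq_bigr => c _.
    by rewrite mulrAC.
  have e2 : sym2_act h P t a b = \sum_c \sum_d h a d * h b c * P t c d.
    rewrite e1 exchange_big; apply: eq_bigr => c _; apply: eq_bigr => d _.
    by rewrite [P t d c]PC.
  apply: (@mulIf _ 2); first by rewrite pnatr_eq0.
  rewrite mulr_natr mulr2n {1}e1 e2 -big_split mulr_suml; apply: eq_bigr => c _.
  rewrite -big_split mulr_suml; apply: eq_bigr => d _.
  by rewrite [RHS]mulrAC divfK ?pnatr_eq0 // mulrDl.
rewrite (@sum_symmetric _ _ (fun c d => (h a c * h b d + h a d * h b c) / 2 * P t c d)).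
  apply: eq_bigr => x _; rewrite !mxE mulrA mulrC; congr (_ * _).
  rewrite /mult2 -/a -/b; case: eqP => [->|_].
    by rewrite mul1r addr0 -mulr2n -[_ *+ 2]mulr_natr mulfK ?pnatr_eq0.
  by rewrite mulrC divfK ?pnatr_eq0.
by move=> c d; rewrite PC addrC.
Qed.

(** The point [Y] is carried to [Y h^-1]: the trace pairing is unchanged when [A] becomes
    [h^-T A h^-1] and the form [S] becomes [h S h^T]. *)
Lemma meets_act h Q : h \in unitmx -> meets Q -> meets (Q *m sym2_act_mx h).
Proof.
move=> uh; rewrite -[Q]unframeK -(frame_act _ (@unframe_sym Q)).
have symA t : (sym2_act h (unframe Q) t)^T = sym2_act h (unframe Q) t.
  by rewrite /sym2_act !trmx_mul trmxK unframe_sym mulmxA.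
move=> /(meets_gramP (@unframe_sym Q))[Y Y0 PY]; apply/(meets_gramP symA).
exists (Y *m invmx h).
  apply: contra Y0 => /eqP e; apply/eqP.
  have : h^T *m ((Y *m invmx h)^T *m (Y *m invmx h)) *m h = 0 by rewrite e mulmx0 mul0mx.
  rewrite !mulmxA mulmxKV // trmx_mul trmx_inv mulmxA mulmxV ?unitmx_tr //.
  by rewrite mul1mx.
move=> t; rewrite trmx_sum_mul symA /sym2_act.
have := PY t; rewrite trmx_sum_mul unframe_sym => e; rewrite -[RHS]e.
rewrite trmx_mul !mulmxA mulmxKV // mxtrace_mulC !mulmxA trmx_inv mulmxV ?unitmx_tr //.
by rewrite mul1mx.
Qed.

Lemma not_killed_not_meets (P : sym2_map K n r.+1) : (forall t, (P t)^T = P t) ->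
  (forall A : 'M[K]_n, A^T = A -> (\rank A <= 4)%N ->
     (forall t, \sum_a \sum_b A a b * P t a b = 0) -> A = 0) ->
  ~ meets (frame_mx P).
Proof.
move=> symP inj /(meets_gramP symP)[Y /eqP Y0 PY]; apply/Y0/inj => //.
  by rewrite trmx_mul trmxK.
exact: leq_trans (mxrankM_maxl _ _) (rank_leq_col _).
Qed.

Lemma meets_codim (Q : 'M[K]_(r, M)) : meets_cone (gram_coords K n) Q.
Proof.
apply: (meets_cone_of_codim uncK (isT : 0 < 2)%N (@gram_coords_homog K n)
  (@gram_coords_closed K n) (ix := @gram_ix m r)).
exact: gram_coords_indep.
Qed.

(** In a linear relation between the rows, a row with nonzero coefficient vanishes wherever the [r]
    others do, and [r] rows always meet the cone. *)
Lemma not_meets_row_free Q : ~ meets Q -> row_free Q.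
Proof.
move=> nQ; rewrite -kermx_eq0; apply: contrapT => /negP/rowV0Pn[l /sub_kermxP lQ l0].
have /rV0Pn[j lj] := l0.
have [y y0 Qy] := meets_codim (row' j Q).
apply: nQ; exists y => //.
have Qy' t : t != j -> (Q *m cone_point (gram_coords K n) y) t 0 = 0.
  case: (unliftP j t) => [t' -> _|->]; last by rewrite eqxx.
  move/colP: Qy => /(_ t'); rewrite [RHS]mxE => <-.
  by rewrite mxE [RHS]mxE; apply: eq_bigr => c _; rewrite [in RHS]mxE.
apply/colP => t; rewrite [RHS]mxE; have [->|] := eqVneq t j; last exact: Qy'.
apply: (mulfI lj); rewrite mulr0.
have : (l *m (Q *m cone_point (gram_coords K n) y)) 0 0 = 0.
  by rewrite mulmxA lQ mul0mx mxE.
by rewrite mxE (bigD1 j) //= big1 ?addr0 // => i ij; rewrite Qy' ?mulr0.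
Qed.

Lemma frame_in_Gr (P : sym2_map K n r.+1) : (forall t, (P t)^T = P t) ->
  row_free (frame_mx P) -> in_Gr P.
Proof.
move=> symP fP; split=> // y.
pose x : 'cV[K]_M := pinvmx (frame_mx P) *m y^T.
exists (sym_of x) => [|t]; first exact: sym_of_sym.
rewrite sum_sym_of //; have := congr1 (fun Z : 'cV_r.+1 => Z t 0)
  (mulmxA (frame_mx P) (pinvmx (frame_mx P)) y^T).
rewrite mulmxVp // mul1mx [y^T _ _]mxE => <-; rewrite mul_colE.
by apply: eq_bigr => c _; rewrite [frame_mx _ _ _]mxE.
Qed.

Lemma frame_semistable (P : sym2_map K n r.+1) : (forall t, (P t)^T = P t) ->
  ~ meets (frame_mx P) -> semistable P.
Proof.
move=> symP nP; set P0 := frame_mx P in nP *.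
have [F [IF F0 FP gen]] := chow_form_exists (@pchar_num K) uncK
  (isT : 0 < 2)%N (@gram_coords_homog K n) (@gram_coords_closed K n)
  (gram_coords_indep m_gt2 r_eq) nP.
have semi A B := chow_form_semi_invariant (A := A) (B := B) IF F0 gen.
have mul1 B Q : 1%:M *m Q *m B = Q *m B by rewrite mul1mx.
have /choice[chi chiE] : forall g, exists c, forall Q,
    mxeval F (g *m Q) = c * mxeval F Q.
  move=> g; have [|c cP] := semi g 1%:M; last by exists c => Q; rewrite -cP mulmx1.
  by move=> Q [y y0 Qy]; exists y; rewrite // mulmx1 -mulmxA Qy mulmx0.
have chi0 g : chi g = mxeval F (g *m P0) / mxeval F P0 by rewrite chiE mulfK.
have [d dP] : exists d, forall g, g \in unitmx -> chi g = \det g ^+ d.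
  apply: polynomial_character => [|A B _ _|A].
  - by rewrite chi0 mul1mx divff.
  - by rewrite [LHS]chi0 -mulmxA !chiE mulrA mulfK.
  - exists (mxpath F (A *m map_mx polyC P0) * ((mxeval F P0)^-1)%:P) => s.
    rewrite hornerM hornerC horner_mxpath map_mxM chi0.
    by rewrite map_horner_polyC.
have [e eP] : exists e, forall h, h \in unitmx -> forall Q,
    mxeval F (Q *m sym2_act_mx h) = \det h ^+ e * mxeval F Q.
  (* [psi] goes through [sym2_act] itself, whose multiplicativity in [h] is immediate, rather than
     through [sym2_act_mx]. *)
  pose psi h := mxeval F (frame_mx (sym2_act h P)) / mxeval F P0.
  have psiE h : h \in unitmx -> forall Q, mxeval F (Q *m sym2_act_mx h) = psi h * mxeval F Q.
    move=> uh Q; have [|c cP] := semi 1%:M (sym2_act_mx h).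
      by move=> Q' mQ'; rewrite mul1; apply: meets_act.
    by rewrite /psi (frame_act h symP) -/P0 -[Q *m _]mul1 -[P0 *m _]mul1 !cP mulfK.
  have actM g h t : sym2_act (g *m h) P t = sym2_act g (sym2_act h P) t.
    by rewrite /sym2_act trmx_mul !mulmxA.
  have [|A B uA uB|A|e eP] := @polynomial_character K m psi.
  - rewrite /psi (_ : sym2_act 1%:M P = P) ?divff //; apply: funext => t.
    by rewrite /sym2_act mul1mx trmx1 mulmx1.
  - have symB t : (sym2_act B P t)^T = sym2_act B P t.
      by rewrite /sym2_act !trmx_mul trmxK symP mulmxA.
    rewrite {1}/psi (_ : sym2_act (A *m B) P = sym2_act A (sym2_act B P)).
      by rewrite frame_act // psiE // -mulrA.
    by apply: funext => t; exact: actM.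
  - pose Ap : 'M[{poly K}]_(r.+1, M) := \matrix_(t, c)
      (A *m map_mx polyC (P t) *m A^T) (mon2_nth c).1 (mon2_nth c).2.
    exists (mxpath F Ap * ((mxeval F P0)^-1)%:P) => s.
    rewrite hornerM hornerC horner_mxpath /psi; congr (mxeval F _ / _).
    apply/matrixP => t c; rewrite mxE [Ap _ _]mxE [RHS]mxE /sym2_act.
    have <- : map_mx (horner_eval s) (A *m map_mx polyC (P t) *m A^T) =
        map_mx (horner_eval s) A *m P t *m (map_mx (horner_eval s) A)^T.
      by rewrite !map_mxM map_horner_polyC map_trmx.
    by rewrite [RHS]mxE.
  exists e => h uh Q; rewrite psiE //; congr (_ * _); exact: eP.
have F_semi g Q : g \in unitmx -> mxeval F (g *m Q) = \det g ^+ d * mxeval F Q.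
  by move=> ug; rewrite chiE dP.
have [G [hG GE]] := semi_invariant_plucker F_semi.
exists d, G; split=> //; last by rewrite GE.
  (* If [d = 0], then [G] is constant and [F] takes the same value at [P] as at the zero matrix,
     which meets the cone; so [F] would vanish at [P]. *)
  rewrite lt0n; apply: contra FP => /eqP d0; rewrite d0 in hG.
  have Gc (Q : sym2_map K n r.+1) : G.@[plucker Q] = G@_0.
    have sG : (msize G <= 1)%N.
      by rewrite msizeE; apply/bigmax_leqP_seq => u uG _; rewrite (dhomog_mf hG uG).
    by rewrite [in LHS](msize1_polyC sG) mevalC.
  rewrite -GE Gc -(Gc (fun=> 0)) GE (_ : frame_mx _ = 0); last first.
    by apply/matrixP => t c; rewrite !mxE.
  have [y y0 _] := meets_codim 0.
  by apply/eqP/IF; exists y; rewrite // mul0mx.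
move=> h Q h1 [symQ _]; rewrite !GE frame_act // eP ?h1 ?expr1n ?mul1r //.
by rewrite unitmxE h1 unitr1.
Qed.

End Semistability.

(** * Second Hilbert points *)

Lemma sym2_quotient_semistable (K : numClosedFieldType) (n k : nat)
    (P : sym2_map K n k) : uncountable_type K -> (3 < n)%N -> (k + 6 = 4 * n)%N ->
  (forall t, (P t)^T = P t) ->
  (forall A : 'M[K]_n, A^T = A -> (\rank A <= 4)%N ->
     (forall t, \sum_a \sum_b A a b * P t a b = 0) -> A = 0) ->
  in_Gr P /\ semistable P.
Proof.
case: n P => // m P; case: k P => [|r] P uncK m2 kE symP inj; first by lia.
have nP := not_killed_not_meets symP inj.
split; last exact: (frame_semistable uncK m2 kE symP nP).
exact: (frame_in_Gr symP (not_meets_row_free uncK m2 kE nP)).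
Qed.

Section HilbertPoint.
Variables (K : fieldType) (N : nat) (X : hpoint K N -> Prop) (L : bundle K N).
Variables (n k : nat) (s : 'I_n -> 'I_(bn L) * hpoint K N -> K) (P : sym2_map K n k).
Hypothesis hP : second_Hilbert_point X s P.

(** The products [s_a s_b] and [s_b s_a] agree and coordinates are unique. Uniqueness is invoked for
    [u t], known to be a section, to which the vanishing combination [D] is added; this avoids
    showing that [s_a s_b] is a section. *)
Lemma second_Hilbert_point_sym t : (P t)^T = P t.
Proof.
have [u [[Zu uniq_u] prod_u]] := hP.
apply/matrixP => a b; rewrite mxE; apply/eqP; rewrite -subr_eq0; apply/eqP.
have [c [_ cu]] := uniq_u (u t) (Zu t).
pose e : 'rV[K]_k := delta_mx 0 t; pose D : 'rV[K]_k := \row_l (P l b a - P l a b).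
have eE j x : \sum_(l < k) e 0 l * u l (j, x) = u t (j, x).
  rewrite (bigD1 t) //= big1 => [|l lt]; first by rewrite mxE !eqxx mul1r addr0.
  by rewrite mxE (negPf lt) andbF mul0r.
have ce : c = e by apply: cu => j x Xx Ux; rewrite eE subrr.
have : c = e + D.
  apply: cu => j x Xx Ux.
  under eq_bigr do rewrite mxE mulrDl.
  rewrite big_split /= eE opprD addNKr.
  apply/eqP; rewrite oppr_eq0; apply/eqP.
  under eq_bigr do rewrite mxE mulrBl.
  have := prod_u b a j x Xx Ux; have := prod_u a b j x Xx Ux.
  move=> /eqP; rewrite subr_eq0 => /eqP eab /eqP; rewrite subr_eq0 => /eqP eba.
  by rewrite sumrB -eab -eba mulrC subrr.
rewrite ce => /eqP; rewrite -subr_eq0 opprD addrA subrr sub0r oppr_eq0 => /eqP/rowP/(_ t).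
by rewrite !mxE.
Qed.

Lemma second_Hilbert_point_ker (A : 'M[K]_n) : A^T = A ->
  (forall t, \sum_a \sum_b A a b * P t a b = 0) -> in_I2 X s A.
Proof.
move=> symA PA; split=> // j x Xx Ux; have [u [_ prod_u]] := hP.
transitivity (\sum_a \sum_b \sum_l A a b * P l a b * u l (j, x)).
  apply: eq_bigr => a _; apply: eq_bigr => b _.
  have := prod_u a b j x Xx Ux; move/eqP; rewrite subr_eq0 => /eqP ->.
  by rewrite mulr_sumr; apply: eq_bigr => l _; rewrite mulrA.
under eq_bigr do rewrite exchange_big.
rewrite exchange_big big1 // => l _ /=.
transitivity ((\sum_a \sum_b A a b * P l a b) * u l (j, x)); last by rewrite PA mul0r.
by rewrite mulr_suml; apply: eq_bigr => a _; rewrite mulr_suml.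
Qed.
End HilbertPoint.

Theorem theorem1p5 (R : realType) (g : nat) (hg : (4 <= g)%N)
    (N : nat) (X : hpoint (complex R) N -> Prop) (L : bundle (complex R) N)
    (hXL : polarized_K3 g X L) (hD : ~ D_rk4 X L)
    (s : 'I_g.+1 -> 'I_(bn L) * hpoint (complex R) N -> complex R)
    (hs : H0_basis X s)
    (P : sym2_map (complex R) g.+1 (4 * g - 2))
    (hP : second_Hilbert_point X s P) :
  in_Gr P /\ semistable P.
Proof.
apply: (@sym2_quotient_semistable R[i] _ _ P (uncountable_complex (R := R))) => //.
- by lia.
- by lia.
- exact: second_Hilbert_point_sym hP.
move=> A symA rkA PA; apply/eqP; apply: contrapT => /negP A0; apply: hD.
by exists g.+1, s, A; split=> //; exact: second_Hilbert_point_ker hP A symA PA.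
Qed.
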